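(* Let $G$ be a broadcasting with side information problem with message set $V=[n]$ and $m$ receivers, and for $k=1,\dots,n$ let $b_k$ be the optimal value of the linear program $\mathcal{B}_k$ defined below. Then: (a) each $\mathcal{B}_k$ is a relaxation of $\mathcal{B}_{k+1}$, so $b_1\le b_2\le\cdots\le b_n$; (b) the broadcast rate satisfies $b_2\le \beta(G)\le b_n$; (c) both inequalities in (b) can be strict: there exist broadcasting with side information problems with $b_2<\beta$, and there exist broadcasting with side information problems with $\beta<b_n$; (d) when $G$ is a graph (undirected side-information graph), $b_1=\alpha(G)$, the independence number of $G$, and $b_n=\overline{\chi}_f(G)$, the fractional clique-cover number of $G$.
   Context: A broadcasting with side information problem: a server holds messages $x_1,\dots,x_n\in\Sigma$ ($|\Sigma|>1$); there are receivers $R_1,\dots,R_m$; receiver $R_j$ wants $x_{f(j)}$ and knows the messages indexed by a set $N(j)\subseteq[n]\setminus\{f(j)\}$. A solution is an encoding $\mathcal{E}:\Sigma^n\to\Sigma_P$ such that every $R_j$ can determine $x_{f(j)}$ from $\mathcal{E}(x_1,\dots,x_n)$ and $(x_i)_{i\in N(j)}$, for all possible message values. $\beta_t(G)$ is the minimum of $\lceil\log_2|\Sigma_P|\rceil$ over solutions with $|\Sigma|=2^t$, and the broadcast rate is $\beta(G)=\lim_{t\to\infty}\beta_t(G)/t=\inf_t\beta_t(G)/t$. ''$G$ is a graph'' means $m=n$, $f(j)=j$, and there is an undirected graph on $[n]$ such that $N(i)$ is the neighborhood of $i$. For $A,B\subseteq V$, write $A\rightsquigarrow B$ (''$A$ decodes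 $B$'') if $A\subseteq B$ and for every $x\in B\setminus A$ there is a receiver $R_j$ with $f(j)=x$ and $N(j)\subseteq A$. The LP $\mathcal{B}_k$ has a variable $X(S)$ for each $S\subseteq V$ and is: minimize $X(\emptyset)$ subject to $X(V)\ge n$; $X(\emptyset)\ge0$; $X(S)+|T\setminus S|\ge X(T)$ for all $S\subseteq T\subseteq V$; $X(T)\ge X(S)$ for all $S\subseteq T\subseteq V$; $X(A)\ge X(B)$ whenever $A\rightsquigarrow B$; and $\sum_{T\subseteq R}(-1)^{|R\setminus T|}X(T\cup Z)\le 0$ for all $R\subseteq V$ with $2\le|R|\le k$ and all $Z\subseteq V$ with $Z\cap R=\emptyset$. The fractional clique-cover number $\overline{\chi}_f$ is the minimum total weight of a nonnegative weighting of the cliques of the graph such that every vertex lies in cliques of total weight at least $1$. *)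

(* Defs.v *)
From HB Require Import structures.
From mathcomp Require Import all_boot all_order all_algebra.
From mathcomp Require Import classical_sets reals.

Import Order.TTheory GRing.Theory Num.Theory.
Local Open Scope ring_scope.

Record bsi := BSI {
  nmsg : nat;
  nrec : nat;
  want : 'I_nrec -> 'I_nmsg;
  know : 'I_nrec -> {set 'I_nmsg};
  want_notin_know : forall j, want j \notin know j }.

Definition msgs (G : bsi) (t : nat) := {ffun 'I_(nmsg G) -> 'I_(2 ^ t)}.

Definition restrict (G : bsi) (t : nat) (A : {set 'I_(nmsg G)}) (x : msgs G t)
  : {ffun 'I_(nmsg G) -> option 'I_(2 ^ t)} :=
  [ffun i => if i \in A then Some (x i) else None].

Definition solution (G : bsi) (t p : nat) : Prop :=
  exists E : msgs G t -> 'I_p,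
  exists D : forall j : 'I_(nrec G),
      'I_p -> {ffun 'I_(nmsg G) -> option 'I_(2 ^ t)} -> 'I_(2 ^ t),
  forall (x : msgs G t) (j : 'I_(nrec G)),
    D j (E x) (restrict G t (know G j) x) = x (want G j).

Definition beta_t (R : realType) (G : bsi) (t : nat) : R :=
  inf (fun r : R => exists2 p, solution G t p & r = (up_log 2 p)%:R).

Definition beta (R : realType) (G : bsi) : R :=
  inf (fun r : R => exists2 t, (0 < t)%N & r = beta_t R G t / t%:R).

Definition decodes (G : bsi) (A B : {set 'I_(nmsg G)}) : Prop :=
  A \subset B /\
  forall x, x \in B :\: A -> exists j, want G j = x /\ know G j \subset A.

Definition feasible (R : realType) (G : bsi) (k : nat)
  (X : {set 'I_(nmsg G)} -> R) : Prop :=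
  [/\ (nmsg G)%:R <= X [set: 'I_(nmsg G)]%SET,
      0 <= X (finset.set0 : {set 'I_(nmsg G)}),
      (forall S T : {set 'I_(nmsg G)}, S \subset T -> X T <= X S + #|T :\: S|%:R),
      (forall S T : {set 'I_(nmsg G)}, S \subset T -> X S <= X T) &
      (forall A B : {set 'I_(nmsg G)}, decodes G A B -> X B <= X A)] /\
      (forall Rs Z : {set 'I_(nmsg G)}, (2 <= #|Rs|)%N -> (#|Rs| <= k)%N ->
          Z :&: Rs = finset.set0 ->
          \sum_(T : {set 'I_(nmsg G)} | T \subset Rs)
             (-1) ^+ #|Rs :\: T| * X (T :|: Z) <= 0).

Definition bval (R : realType) (G : bsi) (k : nat) : R :=
  inf (fun r : R => exists2 X, feasible R G k X & r = X (finset.set0 : {set 'I_(nmsg G)})).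

Definition graph_bsi (n : nat) (e : rel 'I_n) (irr : irreflexive e) : bsi :=
  @BSI n n id (fun i => [set j | e i j])
    (fun i => ltac:(by rewrite inE irr)).

Definition independent (n : nat) (e : rel 'I_n) (S : {set 'I_n}) : bool :=
  [forall x in S, forall y in S, ~~ e x y].

Definition clique (n : nat) (e : rel 'I_n) (C : {set 'I_n}) : bool :=
  [forall x in C, forall y in C, (x != y) ==> e x y].

Definition alpha (n : nat) (e : rel 'I_n) : nat :=
  \max_(S : {set 'I_n} | independent n e S) #|S|.

Definition frac_clique_cover (R : realType) (n : nat) (e : rel 'I_n) : R :=
  inf (fun r : R => exists2 w : {set 'I_n} -> R,
        (forall C, clique n e C -> 0 <= w C) /\
        (forall v, 1 <= \sum_(C : {set 'I_n} | clique n e C && (v \in C)) w C)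
      & r = \sum_(C : {set 'I_n} | clique n e C) w C).

(* Main.v *)
Require Import Defs.
From HB Require Import structures.
From Stdlib Require Import Btauto.
From mathcomp Require Import all_boot all_order all_algebra all_field.
From mathcomp Require Import zify ring lra.
From mathcomp Require Import exp.
From mathcomp Require Import classical_sets reals.
From mathcomp Require Import fintype finset.
Import Order.TTheory GRing.Theory Num.Theory.
Local Open Scope ring_scope.

(** Lower bound on the rate: for uniformly random messages and a solution E, the
    normalised entropies X(S) = H(x_S, E(x)) satisfy B_2.  They also satisfy the
    Zhang-Yeung inequality, which is violated by the rank function of the Vamos
    matroid; for a problem built from the circuits of that matroid the rank
    function gives b_2 <= 4, whereas Zhang-Yeung forces beta >= 45/11.

    Upper bound: the last constraints of B_n say that all differences of order
    at least 2 of g(S) = |S| - X(S) + X(0) are nonnegative, so the Moebius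
    transform m of g is a nonnegative weighting of sets of total at most X(0).
    The decoding constraint for receiver j says that the sets T with
    f(j) \in T \subset f(j) + N(j) have total weight at least 1.  A
    Reed-Solomon code that broadcasts sums over T at rate m(T) is then a
    solution of rate about \sum m.  For a graph such weightings amount to
    fractional clique covers: replace T by the set of those i in T with
    T \subset i + N(i), which is a clique.

    The bound beta <= b_n is strict for the directed triangle, where
    (x0 + x1, x1 + x2) is a solution but no set serves two receivers. *)

(** * Entropy *)

(** A random variable is encoded by its kernel, an equivalence relation on the sample space: joint
    variables are intersections, and coarser relations carry less information. *)
Definition class_prob (R : realType) (U : finType) (p : U -> R) (e : rel U) (x : U) : R :=
  \sum_(y | e x y) p y.

(** Summing over outcomes rather than over classes avoids quotients; the logarithm is natural. *)
Definition entropy (R : realType) (U : finType) (p : U -> R) (e : rel U) : R :=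
  - \sum_x p x * ln (class_prob R U p e x).

Arguments class_prob {R U} p e x.
Arguments entropy {R U} p e.

Definition distribution (R : realType) (U : finType) (p : U -> R) : Prop :=
  (forall x, 0 <= p x) /\ \sum_x p x = 1.

Arguments distribution {R U} p.

Lemma class_prob_ge0 (R : realType) (U : finType) (p : U -> R) (e : rel U) x :
  distribution p -> 0 <= class_prob p e x.
Proof. by case=> p0 _; apply: sumr_ge0. Qed.

Lemma class_prob_gt0 (R : realType) (U : finType) (p : U -> R) (e : rel U) x :
  distribution p -> equivalence_rel e -> 0 < p x -> 0 < class_prob p e x.
Proof.
case=> p0 _ eqe px; rewrite /class_prob (bigD1 x) /=; last by rewrite (eqe x x x).1.
by rewrite ltr_pwDl // sumr_ge0.
Qed.

Lemma class_prob_congr (R : realType) (U : finType) (p : U -> R) (e : rel U) x y :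
  equivalence_rel e -> e x y -> class_prob p e x = class_prob p e y.
Proof.
by move=> eqe exy; apply: eq_bigl => z; case: (eqe x y z) => _ ->.
Qed.

(** This tangent-line bound is the source of the two basic inequalities [entropy_submod] and
    [entropy_kernel_le]. *)
Lemma oppr_ln_ge (R : realType) (x : R) : 0 < x -> 1 - x <= - ln x.
Proof.
move=> x0; have := expR_ge1Dx (ln x); rewrite lnK ?posrE //; lra.
Qed.

(** Agreement on the support suffices; in [zhang_yeung] two relations agree only on the pairs that
    the copy construction charges. *)
Lemma entropy_ext (R : realType) (U : finType) (p : U -> R) (e e' : rel U) :
  (forall x y, p x != 0 -> p y != 0 -> e x y = e' x y) -> entropy p e = entropy p e'.
Proof.
move=> ee; rewrite /entropy; congr (- _); apply: eq_bigr => x _.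
have [->|px] := eqVneq (p x) 0; first by rewrite !mul0r.
congr (_ * ln _); rewrite /class_prob big_mkcond [RHS]big_mkcond /=.
apply: eq_bigr => y _; have [->|py] := eqVneq (p y) 0; first by rewrite !if_same.
by rewrite ee.
Qed.

Lemma equivalence_relI (U : Type) (e f : rel U) :
  equivalence_rel e -> equivalence_rel f -> equivalence_rel (fun x y => e x y && f x y).
Proof.
move=> ee ef x y z; split; first by rewrite (ee x y z).1 (ef x y z).1.
by case/andP=> exy fxy; rewrite ((ee x y z).2 exy) ((ef x y z).2 fxy).
Qed.

(** Expand the product of class probabilities over u in the [e1]-class and v in the [e2]-class of x.
    For fixed u and v the admissible x form at most one [e12]-class, whose mass cancels; what
    remains is bounded by a sum over [e]-related pairs, which telescopes to the total mass. *)
Lemma overlap_le1 (R : realType) (U : finType) (p : U -> R) (e e1 e2 e12 : rel U) :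
  distribution p -> equivalence_rel e -> equivalence_rel e1 -> equivalence_rel e2 ->
  (forall x y, e12 x y = e1 x y && e2 x y) ->
  (forall x y, e1 x y -> e x y) -> (forall x y, e2 x y -> e x y) ->
  \sum_x p x * (class_prob p e1 x * class_prob p e2 x /
                 (class_prob p e12 x * class_prob p e x)) <= 1.
Proof.
move=> dp eqe eq1 eq2 e12E sub1 sub2; have [p0 p1] := dp.
have eq12 : equivalence_rel e12.
  by move=> x y z; rewrite !e12E; apply: (equivalence_relI _ _ _ eq1 eq2).
have symr (f : rel U) : equivalence_rel f -> forall x y, f x y = f y x.
  move=> ef x y; have /equivalence_relP[fr ft] := ef.
  by apply/idP/idP => h; rewrite -(ft _ _ h) fr.
pose F x u v := p x * (p u * p v / (class_prob p e12 x * class_prob p e x)).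
have -> : \sum_x p x * (class_prob p e1 x * class_prob p e2 x /
                 (class_prob p e12 x * class_prob p e x)) =
          \sum_u \sum_v \sum_(x | e1 x u && e2 x v) F x u v.
  under eq_bigr => x _.
    rewrite [X in X * class_prob p e2 x]/class_prob [X in _ * X / _]/class_prob.
    rewrite big_distrlr /= big_distrl big_distrr /=.
    under eq_bigr => u _ do rewrite big_distrl big_distrr /=.
    over.
  transitivity (\sum_u \sum_(x | e1 x u) \sum_(v | e2 x v) F x u v).
    by rewrite (exchange_big_dep xpredT).
  by apply: eq_bigr => u _; rewrite (exchange_big_dep xpredT).
apply: (@le_trans _ _ (\sum_u \sum_(v | e u v) p u * p v / class_prob p e u)).
  apply: ler_sum => u _; rewrite [X in _ <= X]big_mkcond /=; apply: ler_sum => v _.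
  have pos0 : 0 <= p u * p v / class_prob p e u.
    by rewrite divr_ge0 ?mulr_ge0 ?class_prob_ge0.
  case: (pickP (fun x => e1 x u && e2 x v)) => [x0 /andP[x0u x0v]|none]; last first.
    by rewrite big_pred0 //; case: ifP.
  have euv : e u v.
    by rewrite -((eqe x0 u v).2 (sub1 _ _ x0u)); apply: sub2.
  rewrite euv.
  have inE x : e1 x u && e2 x v = e12 x0 x.
    rewrite e12E; congr (_ && _).
      by rewrite ((eq1 x0 u x).2 x0u) (symr _ eq1).
    by rewrite ((eq2 x0 v x).2 x0v) (symr _ eq2).
  have -> : \sum_(x | e1 x u && e2 x v) F x u v =
     (\sum_(x | e12 x0 x) p x) / class_prob p e12 x0 * (p u * p v / class_prob p e u).
    rewrite !big_distrl /=; apply: eq_big => // x.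
    rewrite inE => h; rewrite /F -(class_prob_congr _ _ p e12 _ _ eq12 h).
    have xu : e x u by move: h; rewrite -inE => /andP[/sub1].
    by rewrite (class_prob_congr _ _ p e _ _ eqe xu) invfM; ring.
  rewrite -/(class_prob p e12 x0); apply: ler_piMl => //.
  have [->|nz] := eqVneq (class_prob p e12 x0) 0; first by rewrite mul0r.
  by rewrite divff.
rewrite -p1; apply: ler_sum => u _; rewrite -mulr_suml -mulr_sumr -/(class_prob p e u).
have [->|nz] := eqVneq (class_prob p e u) 0; first by rewrite mulr0 mul0r.
by rewrite mulfK.
Qed.

(** This is nonnegativity of the mutual information of [e1] and [e2] given [e]: average -ln r >= 1 -
    r, where r is the ratio in [overlap_le1]. *)
Lemma entropy_submod (R : realType) (U : finType) (p : U -> R) (e e1 e2 e12 : rel U) :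
  distribution p -> equivalence_rel e -> equivalence_rel e1 -> equivalence_rel e2 ->
  (forall x y, e12 x y = e1 x y && e2 x y) ->
  (forall x y, e1 x y -> e x y) -> (forall x y, e2 x y -> e x y) ->
  entropy p e12 + entropy p e <= entropy p e1 + entropy p e2.
Proof.
move=> dp eqe eq1 eq2 e12E sub1 sub2; have [p0 p1] := dp.
have eq12 : equivalence_rel e12.
  by move=> x y z; rewrite !e12E; apply: (equivalence_relI _ _ _ eq1 eq2).
have := overlap_le1 R U p e e1 e2 e12 dp eqe eq1 eq2 e12E sub1 sub2.
rewrite -p1 -subr_ge0 -sumrB => ge0.
rewrite -subr_ge0; apply: (le_trans ge0).
rewrite /entropy -!sumrN -!big_split -sumrB /=; apply: ler_sum => x _.
have := p0 x; rewrite le_eqVlt => /orP[/eqP <-|px]; first by rewrite !mul0r; lra.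
have g f (ef : equivalence_rel f) := class_prob_gt0 _ _ p f x dp ef px.
have := oppr_ln_ge _ _ (divr_gt0 (mulr_gt0 (g _ eq1) (g _ eq2))
                                 (mulr_gt0 (g _ eq12) (g _ eqe))).
rewrite ln_div ?posrE ?mulr_gt0 ?g // !lnM ?posrE ?g // => h.
have := ler_wpM2l (p0 x) h; lra.
Qed.

(** Gibbs' inequality against the uniform distribution on [K]. *)
Lemma entropy_kernel_le (R : realType) (U : finType) (K : finType) (p : U -> R) (f : U -> K) :
  distribution p -> entropy p (fun x y => f x == f y) <= ln #|K|%:R.
Proof.
move=> dp; have [p0 p1] := dp; set e : rel U := fun x y => _.
have eqe : equivalence_rel e.
  by move=> x y z; rewrite /e eqxx; split => // /eqP ->.
have K0 : 0 < #|K|%:R :> R.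
  rewrite ltr0n; case: (pickP (mem U)) => [x _|U0].
    by apply/card_gt0P; exists (f x).
  by move/eqP: p1; rewrite big_pred0 // eq_sym oner_eq0.
(* Each fibre of f contributes 1, or 0 if its mass vanishes, so the sum counts the values of
   positive probability. *)
have tot : \sum_x p x / class_prob p e x <= #|K|%:R.
  rewrite (partition_big f xpredT) //= -sum1_card natr_sum; apply: ler_sum => k _.
  case: (pickP (fun x => f x == k)) => [x0 /eqP fx0|none]; last first.
    by rewrite big_pred0 // ler01.
  have -> : \sum_(x | f x == k) p x / class_prob p e x =
            (\sum_(x | e x0 x) p x) / class_prob p e x0.
    rewrite big_distrl /=; apply: eq_big => [x|x /eqP fx].
      by rewrite /e fx0 eq_sym.
    by congr (_ / _); apply: class_prob_congr; rewrite // /e fx fx0.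
  rewrite -/(class_prob p e x0).
  have [->|nz] := eqVneq (class_prob p e x0) 0; first by rewrite mul0r ler01.
  by rewrite divff.
have : \sum_x p x * (1 - (class_prob p e x)^-1 / #|K|%:R) <=
       \sum_x p x * (ln (class_prob p e x) + ln #|K|%:R).
  apply: ler_sum => x _.
  have := p0 x; rewrite le_eqVlt => /orP[/eqP <-|px]; first by rewrite !mul0r.
  apply: ler_wpM2l => //; have g := class_prob_gt0 _ _ p e x dp eqe px.
  have ig : 0 < (class_prob p e x)^-1 / #|K|%:R by rewrite divr_gt0 ?invr_gt0.
  have := oppr_ln_ge _ _ ig.
  rewrite ln_div ?posrE ?invr_gt0 // lnV ?posrE //; lra.
under eq_bigr => x _ do rewrite mulrBr mulr1 mulrA.
rewrite sumrB -mulr_suml p1.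
under [X in _ <= X -> _]eq_bigr => x _ do rewrite mulrDr.
rewrite big_split /= -mulr_suml p1 mul1r.
have : (\sum_x p x / class_prob p e x) / #|K|%:R <= 1.
  by rewrite ler_pdivrMr // mul1r.
rewrite /entropy; lra.
Qed.

Lemma entropy_true (R : realType) (U : finType) (p : U -> R) :
  distribution p -> entropy p (fun _ _ => true) = 0.
Proof.
case=> _ p1; rewrite /entropy; under eq_bigr => x _.
  rewrite (_ : class_prob p _ x = 1) ?ln1 ?mulr0; first over.
  by rewrite -[RHS]p1; apply: eq_bigl.
by rewrite big1 ?oppr0.
Qed.

Lemma entropy_ge0 (R : realType) (U : finType) (p : U -> R) (e : rel U) :
  distribution p -> equivalence_rel e -> 0 <= entropy p e.
Proof.
move=> dp eqe; have [p0 p1] := dp; rewrite /entropy oppr_ge0; apply: sumr_le0 => x _.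
apply: mulr_ge0_le0 => //; apply: ln_le0; rewrite -p1 /class_prob big_mkcond.
by apply: ler_sum => y _; case: ifP.
Qed.

(** Submodularity with both finer relations equal to [f]. *)
Lemma entropy_mono (R : realType) (U : finType) (p : U -> R) (e f : rel U) :
  distribution p -> equivalence_rel e -> equivalence_rel f ->
  (forall x y, f x y -> e x y) -> entropy p e <= entropy p f.
Proof.
move=> dp eqe eqf sub.
have h := entropy_submod R U p e f f f dp eqe eqf eqf
  (fun x y => esym (andbb _)) sub sub; lra.
Qed.

Definition relI (U : Type) (e f : rel U) : rel U := fun x y => e x y && f x y.

Arguments relI {U} e f x y.

(* The second coordinate is a copy of the first one that shares its class for
   [e] and is independent of it given that class. *)
Definition copy_prob (R : realType) (U : finType) (p : U -> R) (e : rel U) (z : U * U) : R :=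
  if e z.1 z.2 then p z.1 * p z.2 / class_prob p e z.1 else 0.

Arguments copy_prob {R U} p e z.

Lemma equivalence_rel_sym (U : Type) (e : rel U) x y : equivalence_rel e -> e x y = e y x.
Proof.
move=> eqe; have /equivalence_relP[er et] := eqe.
by apply/idP/idP => h; rewrite -(et _ _ h) er.
Qed.

Lemma copy_prob_ge0 (R : realType) (U : finType) (p : U -> R) (e : rel U) z :
  distribution p -> 0 <= copy_prob p e z.
Proof.
move=> dp; have [p0 _] := dp; rewrite /copy_prob; case: ifP => // _.
by rewrite divr_ge0 ?mulr_ge0 ?class_prob_ge0.
Qed.

Lemma copy_prob_swap (R : realType) (U : finType) (p : U -> R) (e : rel U) x y :
  equivalence_rel e -> copy_prob p e (x, y) = copy_prob p e (y, x).
Proof.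
move=> eqe; rewrite /copy_prob /= (equivalence_rel_sym _ _ x y eqe).
case: ifP => // exy; rewrite (class_prob_congr _ _ p e _ _ eqe exy).
by rewrite (mulrC (p x)).
Qed.

Lemma copy_prob_fst (R : realType) (U : finType) (p : U -> R) (e : rel U) x :
  distribution p -> equivalence_rel e -> \sum_y copy_prob p e (x, y) = p x.
Proof.
move=> dp eqe; have [p0 _] := dp.
rewrite -big_mkcond /= -mulr_suml -mulr_sumr -/(class_prob p e x).
have := p0 x; rewrite le_eqVlt => /orP[/eqP <-|px]; first by rewrite !mul0r.
by rewrite mulfK // gt_eqF // class_prob_gt0.
Qed.

Lemma copy_sum_fst (R : realType) (U : finType) (p F : U -> R) (e : rel U) :
  distribution p -> equivalence_rel e ->
  \sum_z copy_prob p e z * F z.1 = \sum_x p x * F x.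
Proof.
move=> dp eqe.
rewrite -(pair_bigA _ (fun x y => copy_prob p e (x, y) * F x)) /=.
by apply: eq_bigr => x _; rewrite -mulr_suml copy_prob_fst.
Qed.

Lemma copy_sum_snd (R : realType) (U : finType) (p F : U -> R) (e : rel U) :
  distribution p -> equivalence_rel e ->
  \sum_z copy_prob p e z * F z.2 = \sum_x p x * F x.
Proof.
move=> dp eqe.
rewrite -(pair_bigA _ (fun x y => copy_prob p e (x, y) * F y)) /= exchange_big /=.
apply: eq_bigr => x _; rewrite -mulr_suml -[in RHS](copy_prob_fst _ _ p e) //.
by congr (_ * _); apply: eq_bigr => y _; rewrite copy_prob_swap.
Qed.

Lemma copy_distribution (R : realType) (U : finType) (p : U -> R) (e : rel U) :
  distribution p -> equivalence_rel e -> distribution (copy_prob p e).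
Proof.
move=> dp eqe; split=> [z|]; first exact: copy_prob_ge0.
have := copy_sum_fst R U p (fun=> 1) e dp eqe.
by under eq_bigr do rewrite mulr1; under [in RHS]eq_bigr do rewrite mulr1; case: dp => _ ->.
Qed.

Lemma class_prob_mulb (R : realType) (U : finType) (p : U -> R) (e : rel U) x :
  class_prob p e x = \sum_y p y * (e x y)%:R.
Proof.
by rewrite /class_prob big_mkcond; apply: eq_bigr => y _; case: ifP; rewrite ?mulr1 ?mulr0.
Qed.

Lemma entropy_fst (R : realType) (U : finType) (p : U -> R) (e f : rel U) :
  distribution p -> equivalence_rel e ->
  entropy (copy_prob p e) (relpre fst f) = entropy p f.
Proof.
move=> dp eqe; rewrite /entropy; congr (- _).
rewrite -(copy_sum_fst R U p (fun x => ln (class_prob p f x)) e) //.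
apply: eq_bigr => z _; congr (_ * ln _); rewrite !class_prob_mulb.
exact: (copy_sum_fst R U p (fun u => (f z.1 u)%:R)).
Qed.

Lemma entropy_snd (R : realType) (U : finType) (p : U -> R) (e f : rel U) :
  distribution p -> equivalence_rel e ->
  entropy (copy_prob p e) (relpre snd f) = entropy p f.
Proof.
move=> dp eqe; rewrite /entropy; congr (- _).
rewrite -(copy_sum_snd R U p (fun x => ln (class_prob p f x)) e) //.
apply: eq_bigr => z _; congr (_ * ln _); rewrite !class_prob_mulb.
exact: (copy_sum_snd R U p (fun u => (f z.2 u)%:R)).
Qed.

Lemma copy_prob_neq0 (R : realType) (U : finType) (p : U -> R) (e : rel U) z :
  copy_prob p e z != 0 -> [/\ e z.1 z.2, p z.1 != 0 & p z.2 != 0].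
Proof.
rewrite /copy_prob; case: ifP => [ez|]; last by rewrite eqxx.
by rewrite !mulf_eq0 !negb_or => /andP[/andP[]].
Qed.

(** The right side is H(f) + H(g | e): the coordinates are conditionally independent given their
    common [e]-class, which [f] determines, so the class probability factorises pointwise. *)
Lemma entropy_copy (R : realType) (U : finType) (p : U -> R) (e f g : rel U) :
  distribution p -> equivalence_rel e -> equivalence_rel f -> equivalence_rel g ->
  (forall x y, f x y -> e x y) ->
  entropy (copy_prob p e) (relI (relpre fst f) (relpre snd g)) =
  entropy p f + entropy p (relI e g) - entropy p e.
Proof.
move=> dp eqe eqf eqg sub; have [p0 p1] := dp.
have eqeg : equivalence_rel (relI e g) by apply: equivalence_relI.
rewrite /entropy.
rewrite -(copy_sum_fst R U p (fun x => ln (class_prob p f x)) e) //.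
rewrite -(copy_sum_snd R U p (fun x => ln (class_prob p (relI e g) x)) e) //.
rewrite -(copy_sum_fst R U p (fun x => ln (class_prob p e x)) e) //.
rewrite -!sumrN -!big_split /=; apply: eq_bigr => z _.
have [->|qz] := eqVneq (copy_prob p e z) 0; first by rewrite !mul0r; lra.
have [ez pz1 pz2] := copy_prob_neq0 _ _ _ _ _ qz.
have g1 f' (ef : equivalence_rel f') : 0 < class_prob p f' z.1.
  by apply: class_prob_gt0; rewrite // lt_neqAle eq_sym pz1 p0.
have g2 f' (ef : equivalence_rel f') : 0 < class_prob p f' z.2.
  by apply: class_prob_gt0; rewrite // lt_neqAle eq_sym pz2 p0.
suff -> : class_prob (copy_prob p e) (relI (relpre fst f) (relpre snd g)) z =
          class_prob p f z.1 * class_prob p (relI e g) z.2 / class_prob p e z.1.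
  by rewrite ln_div ?lnM ?posrE ?mulr_gt0 ?g1 ?g2 //; ring.
rewrite /class_prob big_distrlr /= big_distrl /= -/(class_prob p e z.1).
transitivity (\sum_(u | f z.1 u) \sum_(v | g z.2 v) copy_prob p e (u, v)).
  by rewrite pair_big_dep /=; apply: eq_big => [[u v]|[u v] _].
apply: eq_bigr => u fu; rewrite big_distrl /= big_mkcond [RHS]big_mkcond /=.
apply: eq_bigr => v _; have eu := sub _ _ fu.
have euv : e u v = e z.2 v by rewrite -((eqe z.1 u v).2 eu) ((eqe z.1 z.2 v).2 ez).
rewrite /copy_prob /relI /= euv; case: (g z.2 v); rewrite ?andbF ?andbT //.
by case: ifP => // _; rewrite (class_prob_congr _ _ p e _ _ eqe eu).
Qed.

(* With [r] a copy of [c] over [(a, b)], the Shannon inequality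
   H(r) + H(r|cd) + H(r|abc) + H(r|abd)
     <= 2 H(r|a) + 2 H(r|b) + I(a;b|c) + I(a;b|d) + I(c;d)
   becomes the claim, since every H(r|...) on the left is at least
   H(r|abcd) = H(c|ab). *)
Lemma zhang_yeung (R : realType) (U : finType) (p : U -> R) (a b c d : rel U) :
  distribution p -> equivalence_rel a -> equivalence_rel b ->
  equivalence_rel c -> equivalence_rel d ->
  2 * entropy p a + 2 * entropy p b + entropy p c + entropy p (relI c d) +
  4 * entropy p (relI (relI a b) c) + entropy p (relI (relI a b) d) <=
  3 * entropy p (relI a b) + 3 * entropy p (relI a c) + 3 * entropy p (relI b c) +
  entropy p (relI a d) + entropy p (relI b d).
Proof.
move=> dp ea eb ec ed.
have eab : equivalence_rel (relI a b) by apply: equivalence_relI.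
pose q := copy_prob p (relI a b).
have dq : distribution q by apply: copy_distribution.
(* The flags select which of a, b, c, d enter the joint variable; [K] below adds a flag for r, the
   value of c at the second coordinate. *)
pose k sa sb sc sd : rel U := fun x y =>
  [&& sa ==> a x y, sb ==> b x y, sc ==> c x y & sd ==> d x y].
have eqk sa sb sc sd : equivalence_rel (k sa sb sc sd).
  have eqi s (f : rel U) (ef : equivalence_rel f) : equivalence_rel (fun x y => s ==> f x y).
    by case: s => x y z /=; [exact: ef|].
  by do !apply: equivalence_relI; apply: eqi.
pose K sr sa sb sc sd : rel (U * U) :=
  relI (relpre fst (k sa sb sc sd)) (relpre snd (k false false sr false)).
have eqK sr sa sb sc sd : equivalence_rel (K sr sa sb sc sd).
  have eqpre (V W : Type) (f : V -> W) (e : rel W) :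
    equivalence_rel e -> equivalence_rel (relpre f e) by move=> ee x y z; apply: ee.
  by apply: equivalence_relI; apply: eqpre.
pose h sr sa sb sc sd := entropy q (K sr sa sb sc sd).
have sub r1 a1 b1 c1 d1 r2 a2 b2 c2 d2 :
  h (r1 || r2) (a1 || a2) (b1 || b2) (c1 || c2) (d1 || d2) +
  h (r1 && r2) (a1 && a2) (b1 && b2) (c1 && c2) (d1 && d2) <=
  h r1 a1 b1 c1 d1 + h r2 a2 b2 c2 d2.
  have imps s1 s2 t : (s1 || s2 ==> t) = (s1 ==> t) && (s2 ==> t).
    by case: s1 s2 t => [] [] [].
  have impI s1 s2 t : (s1 ==> t) -> (s1 && s2 ==> t) by case: s1 s2 t => [] [] [].
  have impI' s1 s2 t : (s2 ==> t) -> (s1 && s2 ==> t) by case: s1 s2 t => [] [] [].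
  apply: entropy_submod => // x y; rewrite /K /k /relI /= ?imps.
  - btauto.
  - by case/andP=> /and4P[? ? ? ?] /andP[? _]; rewrite !impI.
  - by case/andP=> /and4P[? ? ? ?] /andP[? _]; rewrite !impI'.
have hfst sa sb sc sd : h false sa sb sc sd = entropy p (k sa sb sc sd).
  by rewrite -(entropy_fst R U p (relI a b)) //; apply: entropy_ext => x y _ _;
    rewrite /K /relI /= andbT.
(* On the support both coordinates have the same a and b, so r together with a, b is distributed
   like c together with a, b. *)
have hsnd sa sb : h true sa sb false false = entropy p (k sa sb true false).
  rewrite -(entropy_snd R U p (relI a b)) //; apply: entropy_ext => x y.
  move=> /copy_prob_neq0[/andP[ax bx] _ _] /copy_prob_neq0[/andP[ay byy] _ _].
  have ea' : a x.1 y.1 = a x.2 y.2.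
    by rewrite ((ea _ _ _).2 ax) (equivalence_rel_sym _ a) // ((ea _ _ _).2 ay)
         equivalence_rel_sym.
  have eb' : b x.1 y.1 = b x.2 y.2.
    by rewrite ((eb _ _ _).2 bx) (equivalence_rel_sym _ b) // ((eb _ _ _).2 byy)
         equivalence_rel_sym.
  by rewrite /K /relI /k /= ea' eb' !andbT andbA.
(* Given ab, the copy r is independent of abcd. *)
have hall : h true true true true true =
  entropy p (k true true true true) + entropy p (k true true true false)
  - entropy p (k true true false false).
  rewrite /h entropy_copy //; last by move=> x y /and4P[? ? _ _]; apply/andP.
  by congr (_ + _ - _); apply: entropy_ext => x y _ _; rewrite /relI /k /= ?andbT ?andbA.
(* The seven terms I(c;d|r), I(a;b|rc), I(a;b|rd), I(r;c|a), I(r;c|b), I(r;d|a), I(r;d|b) are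
   nonnegative; their sum is the Shannon inequality stated above. *)
have s1 := sub true false false true false true false false false true.
have s2 := sub true true false true false true false true true false.
have s3 := sub true true false false true true false true false true.
have s4 := sub true true false false false false true false true false.
have s5 := sub true false true false false false false true true false.
have s6 := sub true true false false false false true false false true.
have s7 := sub true false true false false false false true false true.
(* These three bound H(r|abc), H(r|abd) and H(r|cd) below by H(r|abcd). *)
have s8 := sub true true true true false false true true true true.
have s9 := sub true true true false true false true true true true.
have s10 := sub true false false true true false true true true true.
rewrite /= ?hall ?hfst ?hsnd in s1 s2 s3 s4 s5 s6 s7 s8 s9 s10.
have kE sa sb sc sd e : (forall x y, k sa sb sc sd x y = e x y) ->
  entropy p (k sa sb sc sd) = entropy p e by move=> E; apply: entropy_ext => x y _ _.
rewrite -(kE true false false false a); last by move=> x y; rewrite /k /= andbT.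
rewrite -(kE false true false false b); last by move=> x y; rewrite /k /= andbT.
rewrite -(kE false false true false c); last by move=> x y; rewrite /k /= andbT.
rewrite -(kE false false true true (relI c d)); last by move=> x y.
rewrite -(kE true true false false (relI a b)); last by move=> x y; rewrite /k /= !andbT.
rewrite -(kE true false true false (relI a c)); last by move=> x y; rewrite /k /= !andbT.
rewrite -(kE false true true false (relI b c)); last by move=> x y; rewrite /k /= !andbT.
rewrite -(kE true false false true (relI a d)); last by move=> x y; rewrite /k /= ?andbT.
rewrite -(kE false true false true (relI b d)); last by move=> x y; rewrite /k /= ?andbT.
rewrite -(kE true true true false (relI (relI a b) c)); last first.
  by move=> x y; rewrite /k /relI /= andbT andbA.
rewrite -(kE true true false true (relI (relI a b) d)); last first.
  by move=> x y; rewrite /k /relI /= andbA.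
lra.
Qed.

(** * The linear programs and Moebius inversion *)

Lemma sum_set_split (V : nmodType) (I : finType) (x : I) (P : pred {set I})
    (F : {set I} -> V) :
  \sum_(T | P T) F T = \sum_(T | P T && (x \notin T)) F T +
                       \sum_(T | P (x |: T) && (x \notin T)) F (x |: T).
Proof.
rewrite (bigID (fun T : {set I} => x \notin T)) /=; congr (_ + _).
rewrite (reindex_onto (fun T => x |: T) (fun T => T :\ x)) /=; last first.
  by move=> T /andP[_]; rewrite negbK => xT; rewrite setD1K.
apply: eq_bigl => T; rewrite negbK setU11 andbT; congr (_ && _).
by apply/eqP/idP => [<-|xT]; rewrite ?setD11 ?setU1K.
Qed.

(** If A differs from B, toggling an element of B outside A pairs off terms of opposite sign. *)
Lemma alternating_interval_sum (R : pzRingType) (I : finType) (A B : {set I}) :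
  A \subset B ->
  \sum_(T : {set I} | (A \subset T) && (T \subset B)) (-1) ^+ #|T :\: A| = (A == B)%:R :> R.
Proof.
move=> AB; have [<-|neq] := eqVneq A B.
  rewrite (big_pred1 A) => [|T]; first by rewrite setDv cards0.
  by rewrite /= eqEsubset andbC.
have /subsetPn[x xB xA] : ~~ (B \subset A) by apply: contra neq => BA; rewrite eqEsubset AB.
rewrite (sum_set_split _ _ x).
rewrite [X in _ + X](_ : _ = - \sum_(T : {set I} | (A \subset T) && (T \subset B) && (x \notin T))
   (-1) ^+ #|T :\: A|); first by rewrite subrr.
rewrite -sumrN; apply: eq_big => [T|T /andP[_ xT]].
  rewrite subUset sub1set xB; congr (_ && _ && _).
  apply/idP/idP => [/subsetP AT|AT]; last exact: subset_trans AT (subsetUr _ _).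
  apply/subsetP => y yA; have := AT y yA; rewrite !inE.
  by case: eqP => // yx; rewrite yx (negPf xA) in yA.
rewrite setDUl (_ : [set x] :\: A = [set x]); last by apply/setDidPl; rewrite disjoints1.
by rewrite cardsU1 !inE (negPf xT) andbF exprS mulN1r.
Qed.

Lemma alternating_interval_sum_compl (R : pzRingType) (I : finType) (A B : {set I}) :
  A \subset B ->
  \sum_(T : {set I} | (A \subset T) && (T \subset B)) (-1) ^+ #|B :\: T| = (A == B)%:R :> R.
Proof.
move=> AB; have := alternating_interval_sum R I (~: B) (~: A).
rewrite setCS (inj_eq (can_inj (@setCK I))) eq_sym => /(_ AB) <-.
rewrite [RHS](reindex_inj (can_inj (@setCK I))) /=; apply: eq_big => [T|T _].
  by rewrite !setCS andbC.
by rewrite [in RHS]setDE setCK setIC -setDE.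
Qed.

Definition mobius (R : pzRingType) (I : finType) (g : {set I} -> R) (T : {set I}) : R :=
  \sum_(S : {set I} | S \subset T) (-1) ^+ #|T :\: S| * g S.

Arguments mobius {R I} g T.

Lemma mobius_inversion (R : pzRingType) (I : finType) (g : {set I} -> R) (S : {set I}) :
  \sum_(T : {set I} | T \subset S) mobius g T = g S.
Proof.
rewrite /mobius (exchange_big_dep (fun A : {set I} => A \subset S)) /=; last first.
  by move=> T A TS AT; apply: subset_trans AT TS.
transitivity (\sum_(A : {set I} | A \subset S) (A == S)%:R * g A).
  apply: eq_bigr => A AS; rewrite -mulr_suml -alternating_interval_sum //.
  by congr (_ * _); apply: eq_bigl => T; rewrite andbC.
rewrite (bigD1 S) //= eqxx mul1r big1 ?addr0 // => A /andP[_ /negPf->].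
by rewrite mul0r.
Qed.

Lemma mobius_const (R : pzRingType) (I : finType) (c : R) (T : {set I}) :
  mobius (fun=> c) T = (T == set0)%:R * c.
Proof.
rewrite /mobius -mulr_suml eq_sym -(alternating_interval_sum_compl _ _ set0) ?sub0set //.
by congr (_ * _); apply: eq_bigl => S; rewrite sub0set.
Qed.

(** Write |S| as a sum over its elements x; each x contributes the alternating sum over the interval
    from {x} to T, which vanishes because T is larger than {x}. *)
Lemma mobius_card (R : pzRingType) (I : finType) (T : {set I}) :
  (1 < #|T|)%N -> mobius (fun S => #|S|%:R) T = 0 :> R.
Proof.
move=> T2; rewrite /mobius.
transitivity (\sum_(S : {set I} | S \subset T) \sum_(x in S) (-1) ^+ #|T :\: S| : R).
  by apply: eq_bigr => S _; rewrite sumr_const mulr_natr.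
rewrite (exchange_big_dep (mem T)) /=; last by move=> S x /subsetP; apply.
apply: big1 => x xT.
transitivity (([set x] == T)%:R : R); last first.
  by case: eqP => // xE; rewrite -xE cards1 in T2.
rewrite -alternating_interval_sum_compl ?sub1set //.
by apply: eq_bigl => S; rewrite sub1set andbC.
Qed.

Lemma mobiusD (R : pzRingType) (I : finType) (f g : {set I} -> R) (T : {set I}) :
  mobius (fun S => f S + g S) T = mobius f T + mobius g T.
Proof. by rewrite /mobius -big_split; apply: eq_bigr => S _; rewrite mulrDr. Qed.

Lemma mobiusN (R : pzRingType) (I : finType) (f : {set I} -> R) (T : {set I}) :
  mobius (fun S => - f S) T = - mobius f T.
Proof. by rewrite /mobius -sumrN; apply: eq_bigr => S _; rewrite mulrN. Qed.

(* The m(T) are the Moebius transform of g(S) = |S| - (X(S) - X(0)). *)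
Lemma feasible_cover (R : realType) (G : bsi) (X : {set 'I_(nmsg G)} -> R) :
  feasible R G (nmsg G) X ->
  exists m : {set 'I_(nmsg G)} -> R,
  [/\ forall T, 0 <= m T,
      forall j, 1 <= \sum_(T : {set _} | (want G j \in T) && (T \subset want G j |: know G j)) m T &
      \sum_T m T <= X set0].
Proof.
move=> [[Xn X0 Xslope Xmono Xdec] Xalt].
pose g (S : {set 'I_(nmsg G)}) := #|S|%:R - X S + X set0.
have gE := mobius_inversion R _ g; exists (mobius g); split.
(* For |T| >= 2 this is the last family of constraints with [Z] empty, since cardinality and
   constants have zero transform there. A singleton uses the slope constraint, and the empty set
   gets weight 0. *)
- move=> T; have [T2|] := ltnP 1 #|T|.
    rewrite /g !mobiusD mobiusN mobius_card // mobius_const.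
    have -> : (T == set0) = false by apply: contraTF T2 => /eqP ->; rewrite cards0.
    rewrite mul0r addr0 sub0r oppr_ge0.
    have Tn : (#|T| <= nmsg G)%N by rewrite -[X in (_ <= X)%N]card_ord max_card.
    have := Xalt T set0 T2 Tn; rewrite set0I => /(_ erefl).
    by under eq_bigr do rewrite setU0.
  rewrite leq_eqVlt ltnS leqn0 => /orP[/cards1P[x ->]|]; last first.
    rewrite cards_eq0 => /eqP ->; rewrite -[X in _ <= X]addr0.
    have := gE set0; rewrite (big_pred1 set0) => [->|S]; last by rewrite subset0.
    by rewrite /g cards0; lra.
  have := gE [set x]; rewrite (bigD1 [set x]) //= (big_pred1 set0); last first.
    by move=> S; rewrite /= subset1 andb_orl andbN /=; case: eqP => // ->;
       rewrite eq_sym; apply/eqP => /setP/(_ x); rewrite !inE eqxx.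
  have := gE set0; rewrite (big_pred1 set0) => [->|S]; last by rewrite subset0.
  have := Xslope set0 [set x] (sub0set _); rewrite setD0.
  by rewrite /g cards0 cards1; lra.
(* The sets inside [x |: A] that avoid x have total weight g(A), so the wanted sum is g(x |: A) -
   g(A), and decoding makes it at least 1. *)
- move=> j; set x := want G j; set A := know G j; have xA : x \notin A by apply: want_notin_know.
  have dec : decodes G A (x |: A).
    split; first exact: subsetUr.
    by move=> y; rewrite !inE => /andP[yA]; rewrite (negPf yA) orbF => /eqP ->; exists j.
  have := Xdec _ _ dec.
  have := gE (x |: A); rewrite (bigID (fun T : {set _} => x \in T)) /=.
  rewrite [X in _ + X](_ : _ = g A); last first.
    rewrite -gE; apply: eq_bigl => T; apply/andP/idP => [[Ts xT]|TA].
      by rewrite -(setU1K xA) subsetD1 Ts.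
    split; last by apply: contra xA; apply: (subsetP TA).
    by apply: subset_trans TA (subsetUr _ _).
  under [X in _ -> _ -> _ <= X]eq_bigl do rewrite andbC.
  rewrite /g cardsU1 xA add1n -natr1; lra.
(* The total is g(V) = n - X(V) + X(0), and X(V) >= n. *)
- have := gE setT; under eq_bigl do rewrite subsetT.
  by move=> ->; rewrite /g cardsT card_ord; lra.
Qed.

(** Shows that each program has a feasible point, so that [bval] is the infimum of a nonempty
    set. *)
Lemma const_feasible (R : realType) (G : bsi) (k : nat) :
  feasible R G k (fun=> (nmsg G)%:R).
Proof.
split=> [|S Z S2 _ _]; first by split=> // S T _; rewrite lerDl.
rewrite -/(mobius (fun=> (nmsg G)%:R) S) mobius_const.
by have -> : (S == set0) = false by [apply: contraTF S2 => /eqP ->; rewrite cards0]; rewrite mul0r.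
Qed.

Lemma bval_le (R : realType) (G : bsi) (k : nat) X : feasible R G k X -> bval R G k <= X set0.
Proof.
move=> fX; apply: ge_inf; last by exists X.
by exists 0 => _ [Y [[_ Y0 _ _ _] _] ->].
Qed.

Lemma le_bval (R : realType) (G : bsi) (k : nat) (c : R) :
  (forall X, feasible R G k X -> c <= X set0) -> c <= bval R G k.
Proof.
move=> h; apply: lb_le_inf => [|_ [X fX ->]]; last exact: h.
by exists (nmsg G)%:R; exists (fun=> (nmsg G)%:R) => //; apply: const_feasible.
Qed.

Lemma feasible_weaken (R : realType) (G : bsi) (k : nat) X :
  feasible R G k.+1 X -> feasible R G k X.
Proof. by case=> X1 X2; split=> // S Z S2 Sk; apply: X2 => //; apply: leqW. Qed.

Lemma bval_mono (R : realType) (G : bsi) (k : nat) : bval R G k <= bval R G k.+1.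
Proof. by apply: le_bval => X /feasible_weaken; apply: bval_le. Qed.

(** * Upper bound on the rate *)

Lemma injection_of_card (I J : finType) : (#|I| <= #|J|)%N -> exists f : I -> J, injective f.
Proof.
move=> le; exists (fun i => enum_val (widen_ord le (enum_rank i))) => i j.
by move=> /enum_val_inj /(congr1 val) /= /ord_inj /enum_rank_inj.
Qed.

(** The decoder returns the wanted entry of any message vector consistent with what the receiver
    sees; by hypothesis the choice is immaterial. *)
Lemma solution_of_encoder (G : bsi) (t p : nat) (K : finType) (E : msgs G t -> K) :
  (#|K| <= p)%N ->
  (forall (x y : msgs G t) j, E x = E y -> (forall i, i \in know G j -> x i = y i) ->
     x (want G j) = y (want G j)) ->
  solution G t p.
Proof.
move=> Kp det; have [f finj] : exists f : K -> 'I_p, injective f.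
  by apply: injection_of_card; rewrite card_ord.
(* Default output for inputs consistent with no message vector. *)
have z : 'I_(2 ^ t) by exists 0%N; rewrite expn_gt0.
exists (f \o E), (fun j c k =>
  if [pick x : {ffun 'I_(nmsg G) -> 'I_(2 ^ t)} |
        (f (E x) == c) && (restrict G t (know G j) x == k)] is Some x
  then x (want G j) else z).
move=> x j; case: pickP => [y|/(_ x)]; last by rewrite !eqxx.
case/andP=> /eqP /finj EE /eqP kk; apply: det => // i ik.
by have := congr1 (fun h : {ffun _ -> _} => h i) kk; rewrite !ffunE ik => -[].
Qed.

Lemma beta_t_has_lbound (R : realType) (G : bsi) (t : nat) :
  has_lbound (fun r : R => exists2 p, solution G t p & r = (up_log 2 p)%:R).
Proof. by exists 0 => _ [p _ ->]. Qed.

Lemma trivial_solution (G : bsi) (t : nat) : exists p, solution G t p.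
Proof.
exists #|{ffun 'I_(nmsg G) -> 'I_(2 ^ t)}|.
by apply: (@solution_of_encoder G t _ _ id) => // x y j ->.
Qed.

Lemma le_beta_t (R : realType) (G : bsi) (t : nat) (c : R) :
  (forall p, solution G t p -> c <= (up_log 2 p)%:R) -> c <= beta_t R G t.
Proof.
move=> h; apply: lb_le_inf => [|_ [p sp ->]]; last exact: h.
by have [p sp] := trivial_solution G t; exists (up_log 2 p)%:R; exists p.
Qed.

Lemma le_beta (R : realType) (G : bsi) (c : R) :
  (forall t p, (0 < t)%N -> solution G t p -> c <= (up_log 2 p)%:R / t%:R) -> c <= beta R G.
Proof.
move=> h; apply: lb_le_inf => [|_ [t t0 ->]]; first by exists (beta_t R G 1 / 1); exists 1%N.
rewrite ler_pdivlMr ?ltr0n //; apply: le_beta_t => p sp.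
by rewrite -ler_pdivlMr ?ltr0n //; apply: h.
Qed.

Lemma beta_le (R : realType) (G : bsi) (t p : nat) :
  (0 < t)%N -> solution G t p -> beta R G <= (up_log 2 p)%:R / t%:R.
Proof.
move=> t0 sp; apply: (@le_trans _ _ (beta_t R G t / t%:R)).
  apply: ge_inf; last by exists t.
  exists 0 => _ [u u0 ->]; rewrite divr_ge0 //; exact: le_beta_t.
rewrite ler_wpM2r ?invr_ge0 //; apply: ge_inf; last by exists p.
exact: beta_t_has_lbound.
Qed.

(* Every message is a polynomial of degree < r over GF(2^s), and the (T, l)-th
   broadcast symbol is the sum over T of its values at the (T, l)-th point.
   A receiver cancels the messages it knows, which leaves at least r values of
   the wanted polynomial. *)
Lemma reed_solomon_solution (G : bsi) (q : {set 'I_(nmsg G)} -> nat) (r s : nat) :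
  (0 < s)%N -> (\sum_T q T <= 2 ^ s)%N ->
  (forall j, (r <= \sum_(T : {set _} |
     (want G j \in T) && (T \subset want G j |: know G j)) q T)%N) ->
  solution G (s * r) (2 ^ (s * \sum_T q T)).
Proof.
move=> s0 qs cover.
have [F _ cF] := pPrimePowerField (isT : prime 2) s0.
pose I : finType := {T : {set 'I_(nmsg G)} & 'I_(q T)}.
have cI : #|I| = (\sum_T q T)%N.
  rewrite card_tagged sumnE big_map big_enum /=.
  by apply: eq_bigr => T _; rewrite card_ord.
(* Distinct evaluation points for all pairs (T, l); the field has enough elements by [qs]. *)
have [a ainj] : exists a : I -> F, injective a by apply: injection_of_card; rewrite cI cF.
have [sigma sinj] : exists f : 'I_(2 ^ (s * r)) -> 'rV[F]_r, injective f.
  by apply: injection_of_card; rewrite card_ord card_mx cF mul1n expnM.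
pose P (x : 'I_(2 ^ (s * r))) := rVpoly (sigma x).
pose E (x : msgs G (s * r)) : {ffun I -> F} := [ffun i : I => \sum_(v in tag i) (P (x v)).[a i]].
apply: (@solution_of_encoder G _ _ _ E); first by rewrite card_ffun cI cF expnM.
move=> x y j EE known; set w := want G j.
(* The symbols in which the wanted message is the only unknown one. *)
pose good := [set i : I | (w \in tag i) && (tag i \subset w |: know G j)].
have cgood : (r <= #|good|)%N.
  apply: leq_trans (cover j) _; rewrite -sum1_card.
  rewrite (partition_big (fun i : I => tag i)
    (fun T : {set _} => (w \in T) && (T \subset w |: know G j))) /=; last first.
    by move=> i; rewrite inE.
  apply: leq_sum => T gT; rewrite sum1_card -[X in (X <= _)%N]card_ord.
  rewrite -(card_image (f := fun l : 'I_(q T) => Tagged (fun T => 'I_(q T)) l)); last first.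
    by move=> k l; apply: eq_from_Tagged.
  apply: subset_leq_card; apply/subsetP => _ /imageP[l _ ->].
  by rewrite unfold_in /= inE /= gT eqxx.
have eval i : i \in good -> (P (x w) - P (y w)).[a i] = 0.
  rewrite inE => /andP[wi /subsetP isub].
  have := congr1 (fun h : {ffun I -> F} => h i) EE; rewrite !ffunE.
  rewrite (bigD1 w) //= [in RHS](bigD1 w) //= hornerD hornerN.
  rewrite [X in _ + X = _](eq_bigr (fun v => (P (y v)).[a i])).
    by move/addIr ->; rewrite subrr.
  move=> v /andP[vi vw]; rewrite known //.
  by have := isub v vi; rewrite !inE (negPf vw).
(* Two candidates for the wanted polynomial differ by one of degree below r that vanishes at all the
   good points, at least r of them. *)
apply: sinj; apply: (can_inj (@rVpolyK F r)); apply/eqP; rewrite -subr_eq0.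
apply: contraTT cgood => nz; rewrite -ltnNge.
have := @max_poly_roots _ _ [seq a i | i <- enum good] nz; rewrite size_map -cardE => h.
apply: leq_trans (h _ _) _.
- by apply/allP => _ /mapP[i ig ->]; apply/rootP; apply: eval; rewrite -mem_enum.
- by rewrite map_inj_uniq ?enum_uniq.
- apply: leq_trans (size_polyD _ _) _; rewrite size_polyN geq_max.
  by rewrite !size_poly.
Qed.

(** Approximate [m] by integers [q] over a common denominator [r]. The code has rate (sum of q)/r,
    which exceeds the total of [m] by at most N/r. *)
Lemma beta_le_cover (R : realType) (G : bsi) (m : {set 'I_(nmsg G)} -> R) :
  (forall T, 0 <= m T) ->
  (forall j, 1 <= \sum_(T : {set _} | (want G j \in T) && (T \subset want G j |: know G j)) m T) ->
  beta R G <= \sum_T m T.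
Proof.
move=> m0 cover; apply/ler_addgt0Pr => eps eps0.
set N : R := #|{set 'I_(nmsg G)}|%:R.
pose r := (Num.truncn (N / eps)).+1.
have r0 : 0 < r%:R :> R by rewrite ltr0n.
have Nr : N / r%:R <= eps.
  rewrite ler_pdivrMr // mulrC -ler_pdivrMr //; apply: ltW.
  by have /truncn_itv/andP[] : 0 <= N / eps by rewrite divr_ge0 // ltW.
pose q T := (Num.truncn (r%:R * m T)).+1.
have qT T : r%:R * m T <= (q T)%:R <= r%:R * m T + 1.
  have /truncn_itv/andP[lo hi] : 0 <= r%:R * m T by rewrite mulr_ge0 // ltW.
  by rewrite (ltW hi) /q -natr1 lerD2r.
(* Only makes the field large enough; [s] cancels in the rate. *)
pose s := (\sum_T q T).+1.
have qs : (\sum_T q T <= 2 ^ s)%N by apply: ltnW; apply: ltn_trans (ltn_expl _ _).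
have qcover j : (r <= \sum_(T : {set _} |
    (want G j \in T) && (T \subset want G j |: know G j)) q T)%N.
  rewrite -(ler_nat R) natr_sum; apply: (@le_trans _ _ (\sum_(T : {set _} |
    (want G j \in T) && (T \subset want G j |: know G j)) r%:R * m T)).
    by rewrite -mulr_sumr ler_peMr // ltW.
  by apply: ler_sum => T _; case/andP: (qT T).
have sol := reed_solomon_solution G q r s isT qs qcover.
apply: (le_trans (beta_le R G (s * r) _ _ sol)); first by rewrite muln_gt0.
rewrite up_expnK // !natrM -mulf_div divff ?mul1r ?pnatr_eq0 //.
apply: (@le_trans _ _ ((r%:R * \sum_T m T + N) / r%:R)); last first.
  by rewrite mulrDl [r%:R * _]mulrC mulfK ?gt_eqF // lerD2l.
rewrite ler_wpM2r ?invr_ge0 ?(ltW r0) // natr_sum mulr_sumr /N -sum1_card natr_sum -big_split /=.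
by apply: ler_sum => T _; case/andP: (qT T).
Qed.

Lemma beta_le_bval (R : realType) (G : bsi) : beta R G <= bval R G (nmsg G).
Proof.
apply: le_bval => X /feasible_cover[m [m0 cover tot]].
exact: le_trans (beta_le_cover _ _ m m0 cover) tot.
Qed.

(** * Graphs *)

Lemma independentP (n : nat) (e : rel 'I_n) (S : {set 'I_n}) :
  reflect (forall x y, x \in S -> y \in S -> ~~ e x y) (independent n e S).
Proof.
apply: (iffP forall_inP) => [h x y xS|h x xS]; first by have /forall_inP := h x xS; apply.
by apply/forall_inP => y; apply: h.
Qed.

Lemma cliqueP (n : nat) (e : rel 'I_n) (C : {set 'I_n}) :
  reflect (forall x y, x \in C -> y \in C -> x != y -> e x y) (clique n e C).
Proof.
apply: (iffP forall_inP) => [h x y xC yC|h x xC].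
  by have /forall_inP/(_ y yC)/implyP := h x xC.
by apply/forall_inP => y yC; apply/implyP; apply: h.
Qed.

Lemma clique_sub (n : nat) (e : rel 'I_n) (C D : {set 'I_n}) :
  C \subset D -> clique n e D -> clique n e C.
Proof.
move=> /subsetP CD /cliqueP cD; apply/cliqueP => x y xC yC.
by apply: cD; apply: CD.
Qed.

(** The independence number after deleting S, from which the optimal point |S| + alpha(G - S) of the
    first program is built. *)
Definition alpha_off (n : nat) (e : rel 'I_n) (S : {set 'I_n}) : nat :=
  \max_(I : {set 'I_n} | independent n e I && (I \subset ~: S)) #|I|.

Lemma alpha_off_ge (n : nat) (e : rel 'I_n) (S I : {set 'I_n}) :
  independent n e I -> I \subset ~: S -> (#|I| <= alpha_off n e S)%N.
Proof.
by move=> iI IS; apply: (@leq_bigmax_cond _ _ (fun I : {set 'I_n} => #|I|)); rewrite iI.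
Qed.

Lemma alpha_off_attained (n : nat) (e : rel 'I_n) (S : {set 'I_n}) :
  exists I, [/\ independent n e I, I \subset ~: S & alpha_off n e S = #|I|].
Proof.
have P0 : independent n e set0 && (set0 \subset ~: S).
  by rewrite sub0set andbT; apply/independentP => x y; rewrite inE.
rewrite /alpha_off (bigop.bigmax_eq_arg set0) //.
by case: arg_maxnP => // I /andP[iI IS] _; exists I.
Qed.

Lemma alpha_off0 (n : nat) (e : rel 'I_n) : alpha_off n e set0 = alpha n e.
Proof. by apply: eq_bigl => I; rewrite setC0 subsetT andbT. Qed.

(** For monotonicity, cut an independent set off S into its parts inside and outside T. For
    decoding, every neighbour of a vertex of [B :\: A] lies in A, so an independent set off B stays
    independent when [B :\: A] is added. *)
Lemma alpha_off_feasible (R : realType) (n : nat) (e : rel 'I_n) (irr : irreflexive e) :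
  symmetric e ->
  feasible R (graph_bsi n e irr) 1 (fun S => (#|S| + alpha_off n e S)%:R).
Proof.
move=> syme; split=> [|S Z S2 S1]; last by rewrite leqNgt S2 in S1.
split=> [||S T ST|S T ST|A B [AB dec]] /=.
- by rewrite ler_nat cardsT card_ord leq_addr.
- exact: ler0n.
- rewrite -natrD ler_nat addnAC -(cardsID S T) (setIidPr ST) leq_add2l.
  apply/bigmax_leqP => I /andP[iI IT]; apply: alpha_off_ge => //.
  by apply: subset_trans IT _; rewrite setCS.
- rewrite ler_nat -(cardsID S T) (setIidPr ST) -addnA leq_add2l.
  apply/bigmax_leqP => I /andP[iI IS]; rewrite -(cardsID T I); apply: leq_add.
    apply: subset_leq_card; apply/subsetP => x; rewrite !inE => /andP[xI ->].
    by have := subsetP IS x xI; rewrite inE => ->.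
  apply: alpha_off_ge; last by apply/subsetP => x; rewrite !inE => /andP[].
  apply/independentP => x y; rewrite !inE => /andP[_ xI] /andP[_ yI].
  by move/independentP: iI; apply.
- have decN x y : x \in B :\: A -> e x y -> y \in A.
    move=> xBA exy; have [j [jx sub]] := dec x xBA; move: sub; rewrite /= in jx *.
    by rewrite jx => /subsetP; apply; rewrite inE.
  rewrite ler_nat -(cardsID A B) (setIidPr AB) -addnA leq_add2l.
  have [I [/independentP iI /subsetP IB ->]] := alpha_off_attained n e B.
  have IBn x : x \in I -> x \notin B by move=> /IB; rewrite inE.
  rewrite -cardsUI (_ : (B :\: A) :&: I = set0) ?cards0 ?addn0; last first.
    apply/setP => x; rewrite !inE; case xI : (x \in I); last by rewrite andbF.
    by rewrite (negPf (IBn x xI)) andbF.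
  apply: alpha_off_ge; last first.
    apply/subsetP => x; rewrite !inE => /orP[/andP[] //|/IBn].
    by apply: contra; apply: (subsetP AB).
  apply/independentP => x y; rewrite !(in_setU _ _ I) => /orP[xD|xI] /orP[yD|yI].
  - by apply: contraTN yD => /(decN _ _ xD) yA; rewrite inE yA.
  - by apply: contra (IBn y yI) => /(decN _ _ xD); apply: (subsetP AB).
  - by rewrite syme; apply: contra (IBn x xI) => /(decN _ _ yD); apply: (subsetP AB).
  - exact: iI.
Qed.

(** For the lower bound, the complement of a maximum independent set S decodes everything, whence n
    <= X(~S) <= X(0) + n - |S|. *)
Lemma bval1_graph (R : realType) (n : nat) (e : rel 'I_n) (irr : irreflexive e) :
  symmetric e -> bval R (graph_bsi n e irr) 1 = (alpha n e)%:R.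
Proof.
move=> syme; apply/eqP; rewrite eq_le; apply/andP; split.
  apply: (le_trans (bval_le _ _ _ _ (alpha_off_feasible R n e irr syme))) => /=.
  by rewrite cards0 add0n alpha_off0.
have [S [iS _]] := alpha_off_attained n e set0; rewrite alpha_off0 => ->.
apply: le_bval => X [[/= Xn _ Xslope _ Xdec] _].
have dec : decodes (graph_bsi n e irr) (~: S) setT.
  split=> [|x]; first exact: subsetT.
  rewrite !inE andbT negbK => xS; exists x; split=> //=.
  apply/subsetP => y; rewrite !inE => exy; apply: contraTN exy => yS.
  by move/independentP: iS; apply.
have h1 := Xdec _ _ dec; have := Xslope set0 (~: S) (sub0set _); rewrite setD0 => h2.
have : #|S|%:R + #|~: S|%:R = n%:R :> R by rewrite -natrD cardsC card_ord.
rewrite /= in h1 h2 *; lra.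
Qed.

Lemma frac_clique_cover_le (R : realType) (n : nat) (e : rel 'I_n) (w : {set 'I_n} -> R) :
  (forall C, clique n e C -> 0 <= w C) ->
  (forall v, 1 <= \sum_(C : {set 'I_n} | clique n e C && (v \in C)) w C) ->
  frac_clique_cover R n e <= \sum_(C : {set 'I_n} | clique n e C) w C.
Proof.
move=> w0 w1; apply: ge_inf; last by exists w.
by exists 0 => _ [u [u0 _] ->]; apply: sumr_ge0.
Qed.

Lemma le_frac_clique_cover (R : realType) (n : nat) (e : rel 'I_n) (c : R) :
  (forall w : {set 'I_n} -> R, (forall C, clique n e C -> 0 <= w C) ->
    (forall v, 1 <= \sum_(C : {set 'I_n} | clique n e C && (v \in C)) w C) ->
    c <= \sum_(C : {set 'I_n} | clique n e C) w C) -> c <= frac_clique_cover R n e.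
Proof.
move=> h; apply: lb_le_inf => [|_ [w [w0 w1] ->]]; last exact: h.
exists (\sum_(C : {set 'I_n} | clique n e C) 1); exists (fun=> 1) => //; split=> // v.
rewrite (bigD1 [set v]) /=; first by rewrite lerDl sumr_ge0.
rewrite set11 andbT; apply/cliqueP => x y; rewrite !inE => /eqP -> /eqP ->.
by rewrite eqxx.
Qed.

Lemma frac_clique_cover_le_bval (R : realType) (n : nat) (e : rel 'I_n) (irr : irreflexive e) :
  symmetric e -> frac_clique_cover R n e <= bval R (graph_bsi n e irr) n.
Proof.
move=> syme; apply: le_bval => X /feasible_cover[m [m0 cover]]; apply: le_trans.
(* The receivers that T serves. They form a clique, and pushing [m] forward along [K] preserves the
   load of each vertex. *)
pose K (T : {set 'I_n}) := [set i in T | T \subset i |: [set k | e i k]].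
have clK T : clique n e (K T).
  apply/cliqueP => x y; rewrite !inE => /andP[xT /subsetP sx] /andP[yT _] xy.
  by have := sx y yT; rewrite !inE eq_sym (negPf xy).
rewrite (partition_big K (clique n e)) //=.
apply: frac_clique_cover_le => [C _|v]; first by apply: sumr_ge0.
rewrite (le_trans (cover v)) //=.
rewrite (partition_big K (fun C => clique n e C && (v \in C))) /=; last first.
  by move=> T; rewrite clK inE.
apply: ler_sum => C /andP[_ vC]; rewrite big_mkcond [X in _ <= X]big_mkcond /=.
by apply: ler_sum => T _; case: (K T == C); rewrite ?andbF // andbT; case: ifP.
Qed.

(* Splitting the weight of every set through v between T and T \ v brings the
   load of v down to 1 and leaves the other loads and the total unchanged. *)
Lemma exact_cover (R : realFieldType) (I : finType) (P : pred {set I}) (w : {set I} -> R) :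
  (forall C D : {set I}, C \subset D -> P D -> P C) ->
  (forall C, 0 <= w C) -> (forall C, ~~ P C -> w C = 0) ->
  (forall v, 1 <= \sum_(C : {set I} | v \in C) w C) ->
  exists u : {set I} -> R, [/\ forall C, 0 <= u C, forall C, ~~ P C -> u C = 0,
    forall v, \sum_(C : {set I} | v \in C) u C = 1 & \sum_C u C = \sum_C w C].
Proof.
move=> Psub w0 wP w1.
suff step : forall s : seq I, exists u : {set I} -> R,
  [/\ forall C, 0 <= u C, forall C, ~~ P C -> u C = 0,
    forall v, 1 <= \sum_(C : {set I} | v \in C) u C,
    forall v, v \in s -> \sum_(C : {set I} | v \in C) u C = 1 & \sum_C u C = \sum_C w C].
  have [u [u0 uP _ ue ut]] := step (enum I).
  by exists u; split=> // v; apply: ue; rewrite mem_enum.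
elim=> [|v s [u [u0 uP u1 ue ut]]]; first by exists w.
pose c := \sum_(C : {set I} | v \in C) u C; have c1 : 1 <= c by apply: u1.
have c0 : 0 < c by apply: lt_le_trans c1.
have ic : 0 <= 1 - c^-1 by rewrite subr_ge0 invf_le1.
pose u' (C : {set I}) := if v \in C then u C / c else u C + (1 - c^-1) * u (v |: C).
(* Adding or removing v only moves weight within the pair T, [v |: T], so any family closed under
   this keeps its total. *)
have load (Q : pred {set I}) : (forall T, Q (v |: T) = Q T) ->
    \sum_(C | Q C) u' C = \sum_(C | Q C) u C.
  move=> Qv; rewrite (sum_set_split _ _ v) [RHS](sum_set_split _ _ v).
  under [X in _ + X = _]eq_bigl do rewrite Qv.
  under [X in _ = _ + X]eq_bigl do rewrite Qv.
  rewrite -!big_split; apply: eq_bigr => T /andP[_ /negPf vT] /=.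
  by rewrite /u' vT setU11; field; rewrite gt_eqF.
have loadv : \sum_(C : {set I} | v \in C) u' C = 1.
  transitivity (c / c); last by rewrite divff // gt_eqF.
  by rewrite [in RHS]/c mulr_suml; apply: eq_bigr => T vT; rewrite /u' vT.
have loadu x : x != v -> \sum_(C : {set I} | x \in C) u' C = \sum_(C : {set I} | x \in C) u C.
  by move=> xv; apply: load => T; rewrite !inE (negPf xv).
exists u'; split.
- move=> C; rewrite /u'; case: ifP => _; first by rewrite divr_ge0 // ltW.
  by rewrite addr_ge0 ?mulr_ge0.
- move=> C nC; rewrite /u' (uP C) // mul0r add0r uP ?mulr0 ?if_same //.
  by apply: contra nC; apply: Psub; apply: subsetUr.
- by move=> x; have [->|xv] := eqVneq x v; rewrite ?loadv // loadu.
- move=> x; rewrite inE; have [-> //|xv] := eqVneq x v.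
  by rewrite loadu //; apply: ue.
- by rewrite load.
Qed.

Lemma exact_cover_load (R : realFieldType) (I : finType) (w : {set I} -> R) (D : {set I}) :
  (forall v, \sum_(C : {set I} | v \in C) w C = 1) ->
  #|D|%:R = \sum_C w C * #|C :&: D|%:R.
Proof.
move=> w1; rewrite -sum1_card natr_sum.
under eq_bigr => v _ do rewrite -(w1 v) big_mkcond.
rewrite exchange_big /=; apply: eq_bigr => C _.
rewrite -big_mkcondr /= sumr_const mulr_natr; congr (_ *+ _).
by apply: eq_card => v; rewrite !inE andbC.
Qed.

(** X(S) is |S| plus the weight of the cliques not contained in S, so g has Moebius transform [w] on
    nonempty sets. Exactness turns |S| into a sum over cliques, and monotonicity and decoding are
    then checked clique by clique. *)
Lemma exact_cover_feasible (R : realType) (n : nat) (e : rel 'I_n) (irr : irreflexive e)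
    (w : {set 'I_n} -> R) :
  (forall C, 0 <= w C) -> (forall C, ~~ clique n e C -> w C = 0) ->
  (forall v, \sum_(C : {set 'I_n} | v \in C) w C = 1) ->
  feasible R (graph_bsi n e irr) n
    (fun S => #|S|%:R + \sum_C w C * (1 - (C \subset S)%:R)).
Proof.
move=> w0 wP w1; have card_load D := exact_cover_load _ _ w D w1.
have cardD (S T : {set 'I_n}) : S \subset T -> #|T|%:R = #|S|%:R + #|T :\: S|%:R :> R.
  by move=> ST; rewrite -(cardsID S T) (setIidPr ST) natrD.
split; first split.
- rewrite /= big1 => [|C _]; last by rewrite subsetT subrr mulr0.
  by rewrite addr0 cardsT card_ord.
- rewrite /= cards0 add0r; apply: sumr_ge0 => C _; rewrite mulr_ge0 //.
  by case: (_ \subset _); rewrite ?subrr ?subr0.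
- move=> S T ST; rewrite /= (cardD _ _ ST) addrAC lerD2r lerD2l; apply: ler_sum => C _.
  rewrite ler_wpM2l // lerD2l lerN2 ler_nat.
  by case CS : (C \subset S) => //; rewrite (subset_trans CS ST).
- move=> S T ST; rewrite /= (cardD _ _ ST) -addrA lerD2l card_load -big_split /=.
  apply: ler_sum => C _; rewrite -mulrDr ler_wpM2l //.
  case CT : (C \subset T); last first.
    by have := ler0n R #|C :&: (T :\: S)|; case: (C \subset S) => /=; lra.
  case CS : (C \subset S); first by rewrite subrr addr0.
  have /subsetPn[x xC xS] := negbT CS.
  rewrite subrr subr0 addr0 ler1n; apply/card_gt0P; exists x.
  by rewrite !inE xC xS (subsetP CT).
- move=> A B [AB dec].
  have decN x y : x \in B :\: A -> e x y -> y \in A.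
    move=> xBA exy; have [j [jx sub]] := dec x xBA; move: sub; rewrite /= in jx *.
    by rewrite jx => /subsetP; apply; rewrite inE.
  rewrite /= (cardD _ _ AB) -addrA lerD2l card_load -big_split /=.
  apply: ler_sum => C _; rewrite -mulrDr.
  have [/cliqueP cC|/wP->] := boolP (clique n e C); last by rewrite !mul0r.
  rewrite ler_wpM2l //; have [->|[x]] := set_0Vmem (C :&: (B :\: A)).
    rewrite cards0 add0r lerD2l lerN2 ler_nat.
    by case CA : (C \subset A) => //; rewrite (subset_trans CA AB).
  (* A clique meeting [B :\: A] in x has its other vertices adjacent to x, hence in A. It gains one
     element and becomes contained in B, and the two changes cancel. *)
  rewrite inE => /andP[xC xBA]; have := xBA; rewrite inE => /andP[xA xB].
  have CA y : y \in C -> y != x -> y \in A.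
    by move=> yC yx; apply: (decN x) => //; apply: cC => //; rewrite eq_sym.
  have -> : C :&: (B :\: A) = [set x].
    apply/setP => y; rewrite !inE; have [->|yx] := eqVneq y x; first by rewrite xC xA xB.
    by case yC : (y \in C) => //=; rewrite CA.
  have -> : C \subset B.
    apply/subsetP => y yC; have [->//|yx] := eqVneq y x.
    by apply: (subsetP AB); apply: CA.
  have -> : (C \subset A) = false.
    by apply/negP => /subsetP/(_ x xC); rewrite (negPf xA).
  by rewrite cards1 /=; lra.
- move=> S Z S2 _ ZS; have SZ : Z :&: S = set0 := ZS.
  have -> : \sum_(T : {set 'I_n} | T \subset S) (-1) ^+ #|S :\: T| *
     (#|T :|: Z|%:R + \sum_C w C * (1 - (C \subset T :|: Z)%:R)) =
     mobius (fun T => #|T|%:R + (#|Z|%:R + \sum_C w C)) S -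
     \sum_C w C * \sum_(T : {set 'I_n} | T \subset S)
       (-1) ^+ #|S :\: T| * (C \subset T :|: Z)%:R :> R.
    under [X in _ - X]eq_bigr => C _ do rewrite mulr_sumr.
    rewrite exchange_big /= -sumrB; apply: eq_bigr => T TS.
    rewrite cardsU (_ : T :&: Z = set0) ?cards0 ?subn0; last first.
      by apply/eqP; rewrite -subset0 -SZ setIC setIS.
    under eq_bigr => C _ do rewrite mulrBr mulr1.
    rewrite sumrB natrD.
    under [X in _ = _ - X]eq_bigr => C _ do rewrite mulrCA.
    by rewrite -mulr_sumr; ring.
  rewrite mobiusD mobius_card // mobius_const.
  have -> : (S == set0) = false by apply: contraTF S2 => /eqP ->; rewrite cards0.
  rewrite mul0r addr0 sub0r oppr_le0; apply: sumr_ge0 => C _; rewrite mulr_ge0 //.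
  (* C lies in [T :|: Z] exactly when [C :\: Z] lies in T, so the sum runs over an interval and is 0
     or 1. *)
  apply: (@le_trans _ _ (\sum_(T : {set 'I_n} | (C :\: Z \subset T) && (T \subset S))
    (-1) ^+ #|S :\: T|)); last first.
    rewrite big_mkcond [X in _ <= X]big_mkcond /=; apply: ler_sum => T _.
    rewrite subDset setUC andbC; case: (T \subset S) => //=.
    by case: ifP; rewrite ?mulr1 ?mulr0.
  have [CS|CS] := boolP (C :\: Z \subset S); first by rewrite alternating_interval_sum_compl.
  rewrite big_pred0 // => T; apply/negP => /andP[CT TS].
  by rewrite (subset_trans CT TS) in CS.
Qed.

Lemma bval_le_frac_clique_cover (R : realType) (n : nat) (e : rel 'I_n) (irr : irreflexive e) :
  bval R (graph_bsi n e irr) n <= frac_clique_cover R n e.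
Proof.
apply: le_frac_clique_cover => w w0 w1.
(* A cover is unconstrained off the cliques, so it is cut to zero there before being made exact. *)
pose w' C := if clique n e C then w C else 0.
have [||||u [u0 uP u1 ut]] := exact_cover R _ (clique n e) w'.
- exact: clique_sub.
- by move=> C; rewrite /w'; case: ifP => // /w0.
- by move=> C /negPf nC; rewrite /w' nC.
- move=> v; have := w1 v; congr (_ <= _); rewrite big_mkcondl /=.
  by apply: eq_bigr => C _.
have := bval_le _ _ _ _ (exact_cover_feasible R n e irr u u0 uP u1).
move=> /le_trans; apply => /=; rewrite cards0 add0r [X in _ <= X]big_mkcond /=.
rewrite -/(\sum_C w' C) -ut; apply: ler_sum => C _.
by apply: ler_piMr => //; rewrite gerBl.
Qed.

(** * Lower bound on the rate *)

Lemma subset_add_ind (I : finType) (S T : {set I}) (P : {set I} -> Prop) :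
  S \subset T -> P S ->
  (forall (A : {set I}) x, S \subset A -> x |: A \subset T -> x \notin A ->
     P A -> P (x |: A)) -> P T.
Proof.
move=> ST PS step.
suff aux k : forall A : {set I}, S \subset A -> A \subset T -> (#|T :\: A| <= k)%N -> P A -> P T.
  by apply: (aux #|T :\: S| S).
elim: k => [|k IH] A SA AT cA PA; have [TA|] := boolP (T \subset A).
- by have -> : T = A by apply/eqP; rewrite eqEsubset TA.
- by move: cA; rewrite -setD_eq0 leqn0 cards_eq0 => ->.
- by have -> : T = A by apply/eqP; rewrite eqEsubset TA.
case/subsetPn => x xT xA; have xAT : x |: A \subset T by rewrite subUset sub1set xT.
apply: (IH (x |: A)) => //; last by apply: step.
  by apply: subset_trans SA (subsetUr _ _).
rewrite -ltnS; apply: leq_trans cA; apply: proper_card.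
apply/properP; split; first by rewrite setDS // subsetUr.
by exists x; rewrite !inE ?eqxx ?xA.
Qed.

Lemma sum_subsets_pair (V : nmodType) (I : finType) (a b : I) (F : {set I} -> V) :
  a != b ->
  \sum_(T : {set I} | T \subset [set a; b]) F T =
  F set0 + F [set b] + (F [set a] + F [set a; b]).
Proof.
move=> ab.
have sub1 (H : {set I} -> V) : \sum_(T : {set I} | T \subset [set b]) H T = H set0 + H [set b].
  rewrite (bigD1 set0) ?sub0set //= (big_pred1 [set b]) // => T /=; rewrite subset1.
  have [->|T0] := eqVneq T set0; last by rewrite orbF andbT.
  by rewrite orbT; apply/esym/eqP => /setP/(_ b); rewrite !inE eqxx.
rewrite (sum_set_split _ _ a); congr (_ + _).
  rewrite -sub1; apply: eq_bigl => T; apply/andP/idP => [[Ts aT]|Tb].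
    by rewrite -(@setU1K _ a [set b]) ?subsetD1 ?Ts // inE.
  split; first by apply: subset_trans Tb (subsetUr _ _).
  by apply: contra ab => /(subsetP Tb); rewrite inE.
rewrite -[F [set a]](_ : F (a |: set0) = _); last by rewrite setU0.
rewrite -(sub1 (fun T => F (a |: T))); apply: eq_bigl => T.
apply/andP/idP => [[Ts aT]|Tb].
  rewrite -(@setU1K _ a [set b]) ?subsetD1 ?aT ?inE // andbT.
  by apply: subset_trans Ts; apply: subsetUr.
split; first by rewrite setUS.
by apply: contra ab => /(subsetP Tb); rewrite inE.
Qed.

(** Larger inclusions are climbed one element at a time, and the alternating constraint for a pair
    is submodularity. When decoding, the known set stays inside the growing set. *)
Lemma feasible2_local (R : realType) (G : bsi) (X : {set 'I_(nmsg G)} -> R) :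
  (nmsg G)%:R <= X setT -> 0 <= X set0 ->
  (forall (S : {set _}) x, x \notin S -> X (x |: S) <= X S + 1) ->
  (forall (S : {set _}) x, x \notin S -> X S <= X (x |: S)) ->
  (forall (S : {set _}) j, know G j \subset S -> want G j \notin S -> X (want G j |: S) <= X S) ->
  (forall (Z : {set _}) a b, a != b -> a \notin Z -> b \notin Z ->
     X (a |: (b |: Z)) + X Z <= X (a |: Z) + X (b |: Z)) ->
  feasible R G 2 X.
Proof.
move=> Xn X0 slope mono dec submod; split; first split=> //.
- move=> S T ST; apply: (subset_add_ind _ S T (fun T => X T <= X S + #|T :\: S|%:R)) => //.
    by rewrite setDv cards0 addr0.
  move=> A x SA _ xA XA; apply: (le_trans (slope A x xA)).
  have -> : (x |: A) :\: S = x |: (A :\: S).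
    apply/setP => y; rewrite !inE; case: eqP => // ->; rewrite andbT.
    by apply: contra xA; apply: (subsetP SA).
  by rewrite cardsU1 !inE (negPf xA) andbF add1n -natr1; lra.
- move=> S T ST; apply: (subset_add_ind _ S T (fun T => X S <= X T)) => // A x _ _ xA.
  by move=> /le_trans; apply; apply: mono.
- move=> A B [AB h]; apply: (subset_add_ind _ A B (fun T => X T <= X A)) => // C x AC xCB xC XC.
  have [|j [jx jA]] := h x.
    rewrite inE (subsetP xCB) ?setU11 // andbT.
    by apply: contra xC; apply: (subsetP AC).
  apply: le_trans XC; rewrite -jx; apply: dec; last by rewrite jx.
  exact: subset_trans jA AC.
- move=> S Z S2 S2' ZS; have /cards2P[a [b [ab SE]]] : #|S| == 2 by rewrite eqn_leq S2' S2.
  have notZ x : x \in S -> x \notin Z.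
    by move=> xS; apply/negP => xZ; have /setP/(_ x) := ZS; rewrite !inE xZ xS.
  rewrite SE sum_subsets_pair // setD0 setDv cards0 cards2 ab.
  have -> : [set a; b] :\: [set b] = [set a].
    by rewrite setUC setU1K // inE eq_sym.
  have -> : [set a; b] :\: [set a] = [set b] by rewrite setU1K // inE.
  rewrite !cards1 set0U -setUA.
  have := submod Z a b ab; rewrite !notZ ?SE ?inE ?eqxx ?orbT // => /(_ isT isT).
  lra.
Qed.

Lemma solution_encoder (G : bsi) (t p : nat) : solution G t p ->
  exists E : msgs G t -> 'I_p, forall (x y : msgs G t) j, E x = E y ->
    (forall i, i \in know G j -> x i = y i) -> x (want G j) = y (want G j).
Proof.
case=> E [D sol]; exists E => x y j EE kk; rewrite -!sol EE; congr (D j _ _).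
by apply/ffunP => i; rewrite !ffunE; case: ifP => // ik; rewrite kk.
Qed.

(* X(S) is the entropy of (x_S, E x) for uniform x, in units of the entropy of
   one message. *)
Lemma solution_entropy (R : realType) (G : bsi) (t p : nat) :
  (0 < t)%N -> solution G t p ->
  exists X : {set 'I_(nmsg G)} -> R,
  [/\ feasible R G 2 X, X set0 <= (up_log 2 p)%:R / t%:R &
    forall A B C D, 2 * X A + 2 * X B + X C + X (C :|: D) +
      4 * X (A :|: B :|: C) + X (A :|: B :|: D) <=
      3 * X (A :|: B) + 3 * X (A :|: C) + 3 * X (B :|: C) + X (A :|: D) + X (B :|: D)].
Proof.
move=> t0 /solution_encoder[E det].
pose U : finType := {ffun 'I_(nmsg G) -> 'I_(2 ^ t)}.
have cU : #|U| = (2 ^ (t * nmsg G))%N by rewrite card_ffun !card_ord expnM.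
have U0 : 0 < #|U|%:R :> R by rewrite ltr0n cU expn_gt0.
pose pr (x : U) : R := #|U|%:R^-1.
have dpr : distribution pr.
  split=> [x|]; first by rewrite invr_ge0 ler0n.
  by rewrite /pr sumr_const -[LHS]mulr_natr mulVf // gt_eqF.
(* The kernel of (x_S, E x). *)
pose r (S : {set 'I_(nmsg G)}) : rel U :=
  fun x y => [forall (i | i \in S), x i == y i] && (E x == E y).
have rP (S : {set 'I_(nmsg G)}) (x y : U) :
    reflect ((forall i, i \in S -> x i = y i) /\ E x = E y) (r S x y).
  apply: (iffP andP) => [[/forall_inP h /eqP e]|[h ->]]; last first.
    by rewrite eqxx; split=> //; apply/forall_inP => i iS; rewrite h.
  by split=> // i iS; apply/eqP/h.
have eqr S : equivalence_rel (r S).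
  move=> x y z; split; first by apply/rP.
  move=> /rP[h e]; apply/rP/rP => -[h' e']; split; rewrite ?e // -?e // => i iS.
    by rewrite -h // h'.
  by rewrite h // h'.
have rU S T x y : r (S :|: T) x y = r S x y && r T x y.
  apply/rP/andP => [[h e]|[/rP[h e] /rP[h' _]]].
    by split; apply/rP; split=> // i iS; apply: h; rewrite inE iS ?orbT.
  by split=> // i; rewrite inE => /orP[/h|/h'].
have ln2 : 0 < ln 2 :> R by apply: ln_gt0; rewrite ltr1n.
have tR : 0 < t%:R :> R by rewrite ltr0n.
pose L : R := t%:R * ln 2; have L0 : 0 < L by rewrite mulr_gt0.
have lnpow k : ln ((2 ^ k)%:R : R) = k%:R * ln 2 by rewrite natrX lnXn // mulr_natl.
pose h S := entropy pr (r S).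
have hsub (S S' : {set _}) : S \subset S' -> h S <= h S'.
  move=> /subsetP SS; apply: entropy_mono => // x y /rP[k e]; apply/rP; split=> // i iS.
  by apply: k; apply: SS.
have hT : h setT = (nmsg G)%:R * L.
  have cp x : class_prob pr (r setT) x = #|U|%:R^-1.
    rewrite /class_prob (big_pred1 x) // => y; apply/rP/eqP => [[k _]|-> //].
    by apply/ffunP => i; rewrite k.
  rewrite /h /entropy; under eq_bigr => x _ do rewrite cp.
  rewrite -mulr_suml (proj2 dpr) mul1r lnV ?posrE // opprK cU lnpow natrM /L; ring.
(* Subadditivity, as submodularity over the trivial relation: one message has entropy at most L. *)
have h1 i S : h (i |: S) <= h S + L.
  pose e : rel U := fun x y => x i == y i.
  have He : entropy pr e <= L by rewrite /L -lnpow -[X in X%:R]card_ord; apply: entropy_kernel_le.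
  have ee : equivalence_rel e by move=> x y z; rewrite /e eqxx; split=> // /eqP ->.
  have e0 : equivalence_rel (fun _ _ : U => true) by [].
  have := entropy_submod R U pr (fun _ _ => true) (r S) e (r (i |: S)) dpr e0 (eqr S) ee.
  rewrite entropy_true // addr0 => /(_ _ (fun _ _ _ => isT) (fun _ _ _ => isT)) sm.
  apply: (le_trans (sm _)); last by rewrite lerD2l.
  move=> x y; apply/rP/andP => [[k ex]|[/rP[k ex] /eqP exi]].
    split; last by apply/eqP; apply: k; apply: setU11.
    by apply/rP; split=> // j jS; apply: k; rewrite setU1r.
  by split=> // j; rewrite in_setU1 => /orP[/eqP ->|/k].
exists (fun S => h S / L); split.
- apply: feasible2_local.
  + by rewrite hT mulfK // gt_eqF.
  + by rewrite divr_ge0 ?(ltW L0) //; apply: entropy_ge0.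
  + move=> S x _; rewrite ler_pdivrMr // mulrDl mul1r mulfVK ?gt_eqF //.
  + by move=> S x _; rewrite ler_wpM2r ?invr_ge0 ?(ltW L0) // hsub // subsetUr.
  + move=> S j kS _; rewrite ler_wpM2r ?invr_ge0 ?(ltW L0) //.
    apply: entropy_mono => // x y /rP[k e]; apply/rP; split=> // i.
    rewrite in_setU1 => /orP[/eqP ->|/k //]; apply: det => // l lk.
    by apply: k; apply: (subsetP kS).
  + move=> Z a b _ _ _; rewrite -!mulrDl ler_wpM2r ?invr_ge0 ?(ltW L0) //.
    apply: entropy_submod => // x y.
    * by rewrite -rU setUACA setUid -setUA.
    * by rewrite rU => /andP[].
    * by rewrite rU => /andP[].
- rewrite ler_pdivrMr // /L mulrA mulfVK ?gt_eqF // -lnpow.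
  apply: (@le_trans _ _ (ln #|'I_p|%:R)).
    have := entropy_kernel_le R U _ pr E dpr; congr (_ <= _); apply: entropy_ext => x y _ _.
    by apply/eqP/rP => [->|[]] //; split=> // i; rewrite inE.
  have p0 : (0 < p)%N.
    have /card_gt0P[x _] : (0 < #|U|)%N by rewrite cU expn_gt0.
    by apply: leq_ltn_trans (ltn_ord (E x)).
  rewrite card_ord ler_ln ?posrE ?ltr0n ?expn_gt0 // ler_nat.
  exact: up_logP.
- move=> A B C D.
  have hU S T : h (S :|: T) = entropy pr (relI (r S) (r T)).
    by apply: entropy_ext => x y _ _; rewrite rU.
  have hUU S T V : h (S :|: T :|: V) = entropy pr (relI (relI (r S) (r T)) (r V)).
    by apply: entropy_ext => x y _ _; rewrite /relI !rU.
  have := zhang_yeung R U pr _ _ _ _ dpr (eqr A) (eqr B) (eqr C) (eqr D).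
  rewrite !mulrA -!mulrDl !hUU !hU -/(h A) -/(h B) -/(h C).
  by rewrite -!hU => zy; rewrite ler_wpM2r ?invr_ge0 ?(ltW L0).
Qed.

Lemma bval2_le_beta (R : realType) (G : bsi) : bval R G 2 <= beta R G.
Proof.
apply: le_beta => t p t0 /(solution_entropy R _ _ _ t0)[X [fX X0 _]].
exact: le_trans (bval_le _ _ _ _ fX) X0.
Qed.

(** * The Vamos problem *)

(** Lists of numbers let the finite checks on subsets be done by computation. *)
Definition vset (s : seq nat) : {set 'I_8} := [set i : 'I_8 | (i : nat) \in s].

Lemma card_vset_cond (P : pred nat) : #|[set i : 'I_8 | P i]| = count P (iota 0%N 8%N).
Proof.
rewrite -val_enum_ord count_map -size_filter -(card_uniqP _); last first.
  by rewrite filter_uniq ?enum_uniq.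
by apply: eq_card => i; rewrite inE mem_filter mem_enum andbT.
Qed.

Lemma vset_eq (s1 s2 : seq nat) :
  all (fun k : nat => (k \in s1) == (k \in s2)) (iota 0%N 8%N) -> vset s1 = vset s2.
Proof.
move=> /allP h; apply/setP => i; rewrite !inE; apply/eqP/h.
by rewrite mem_iota /= ltn_ord.
Qed.

Lemma vset_sub (s1 s2 : seq nat) : all (mem s2) s1 -> vset s1 \subset vset s2.
Proof. by move=> /allP h; apply/subsetP => i; rewrite !inE; apply: h. Qed.

Lemma vset_cons (k : nat) (s : seq nat) (i : 'I_8) : (i : nat) = k -> i |: vset s = vset (k :: s).
Proof. by move=> <-; apply/setP => j; rewrite !inE. Qed.

(* The Vamos matroid on the pairs a = {0,1}, b = {2,3}, c = {4,5}, d = {6,7}: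
   all 4-sets are bases except the circuits ab, ac, bc, ad, bd. *)
Definition vamos_circuits : seq (seq nat) :=
  [:: [:: 0; 1; 2; 3]; [:: 0; 1; 4; 5]; [:: 2; 3; 4; 5]; [:: 0; 1; 6; 7]; [:: 2; 3; 6; 7]]%N.

(** Each receiver wants an element of the matroid closure of what it knows: one per circuit, then
    three for the basis cd, and one each for the spanning sets abc and abd. *)
Definition vamos_receivers : seq (nat * seq nat) :=
  [:: (3, [:: 0; 1; 2]); (5, [:: 0; 1; 4]); (5, [:: 2; 3; 4]); (7, [:: 0; 1; 6]);
      (7, [:: 2; 3; 6]); (0, [:: 4; 5; 6; 7]); (1, [:: 4; 5; 6; 7]); (2, [:: 4; 5; 6; 7]);
      (6, [:: 0; 1; 2; 3; 4; 5]); (4, [:: 0; 1; 2; 3; 6; 7])]%N.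

Definition vamos_want (j : 'I_10) : 'I_8 := inord (nth (0%N, [::]) vamos_receivers j).1.

Definition vamos_know (j : 'I_10) : {set 'I_8} := vset (nth (0%N, [::]) vamos_receivers j).2.

Lemma vamos_wantE (j : 'I_10) : vamos_want j = (nth (0%N, [::]) vamos_receivers j).1 :> nat.
Proof.
rewrite inordK //; have /allP : all (fun r : nat * seq nat => r.1 < 8)%N vamos_receivers by [].
by apply; apply: mem_nth.
Qed.

Lemma vamos_want_notin_know (j : 'I_10) : vamos_want j \notin vamos_know j.
Proof.
rewrite inE vamos_wantE.
have /allP : all (fun r : nat * seq nat => r.1 \notin r.2) vamos_receivers by [].
by apply; apply: mem_nth.
Qed.

Definition vamos : bsi := @BSI 8 10 vamos_want vamos_know vamos_want_notin_know.

Definition vamos_rank (S : {set 'I_8}) : nat :=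
  (minn #|S| 4 - (S \in [seq vset s | s <- vamos_circuits]))%N.

Lemma vamos_circuit_card (S : {set 'I_8}) : S \in [seq vset s | s <- vamos_circuits] -> #|S| = 4%N.
Proof.
case/mapP=> s sC ->; rewrite card_vset_cond.
have /allP/(_ s sC)/eqP :
  all (fun s : seq nat => count (mem s) (iota 0%N 8%N) == 4%N) vamos_circuits by [].
by [].
Qed.

(** Distinct circuits share at most two elements; this is what makes the rank function
    submodular. *)
Lemma vamos_circuitI (S T : {set 'I_8}) :
  S \in [seq vset s | s <- vamos_circuits] -> T \in [seq vset s | s <- vamos_circuits] ->
  (2 < #|S :&: T|)%N -> S = T.
Proof.
case/mapP=> s sC -> /mapP[t tC ->].
have -> : vset s :&: vset t =
    [set i : 'I_8 | (i : nat) \in [pred k : nat | (k \in s) && (k \in t)]].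
  by apply/setP => i; rewrite !inE.
rewrite card_vset_cond => st2.
have /allP/(_ s sC)/allP/(_ t tC) : all (fun s : seq nat => all (fun t : seq nat => (s == t) ||
  (count [pred k : nat | (k \in s) && (k \in t)] (iota 0%N 8%N) <= 2)%N)
    vamos_circuits) vamos_circuits by [].
by rewrite leqNgt st2 orbF => /eqP ->.
Qed.

Lemma vamos_rank_free (S : {set 'I_8}) : #|S| != 4%N -> vamos_rank S = minn #|S| 4.
Proof.
rewrite /vamos_rank; case: (boolP (S \in _)) => [/vamos_circuit_card -> //|_ _].
by rewrite subn0.
Qed.

Lemma vamos_rank_bounds (S : {set 'I_8}) :
  (minn #|S| 4 - (#|S| == 4%N) <= vamos_rank S <= minn #|S| 4)%N.
Proof.
rewrite leq_subr andbT /vamos_rank.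
by case: (boolP (S \in _)) => [/vamos_circuit_card ->|_] //; rewrite leq_sub2l.
Qed.

(** A receiver knows either a circuit minus the wanted element, or a set of rank 4. In the first
    case a 4-set S containing the known three is not a circuit, since it would then be the circuit
    containing the wanted element. *)
Lemma vamos_rank_closure (S : {set 'I_8}) (j : 'I_10) :
  vamos_know j \subset S -> vamos_want j \notin S ->
  vamos_rank (vamos_want j |: S) = vamos_rank S.
Proof.
move=> kS wS; have wk := vamos_want_notin_know j.
have c1 : #|vamos_want j |: S| = #|S|.+1 by rewrite cardsU1 wS.
have /orP[/andP[/eqP k3 circ]|/andP[k4 free]] : (#|vamos_know j| == 3%N) &&
     (vamos_want j |: vamos_know j \in [seq vset s | s <- vamos_circuits]) ||
   (3 < #|vamos_know j|)%N && (vamos_know j \notin [seq vset s | s <- vamos_circuits]).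
  rewrite (vset_cons _ _ _ (vamos_wantE j)) /vamos_know card_vset_cond.
  set r := nth _ _ _; have : r \in vamos_receivers by apply: mem_nth.
  move=> rR; have /allP/(_ r rR) : all (fun r : nat * seq nat =>
      (count (mem r.2) (iota 0%N 8%N) == 3%N) &&
      has (fun s : seq nat => all (fun k : nat => (k \in r.1 :: r.2) == (k \in s)) (iota 0%N 8%N))
        vamos_circuits ||
    (3 < count (mem r.2) (iota 0%N 8%N))%N &&
      all (fun s : seq nat => has (fun k : nat => (k \in r.2) != (k \in s)) (iota 0%N 8%N))
        vamos_circuits)
    vamos_receivers by [].
  case/orP=> /andP[->].
    by case/hasP=> s sC /vset_eq ->; rewrite map_f.
  move=> /allP h; apply/orP; right; apply/mapP => -[s sC /setP e].
  have /hasP[k k8] := h s sC; rewrite mem_iota /= in k8.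
  by have := e (Ordinal k8); rewrite !inE /= => ->; rewrite eqxx.
- have : (#|vamos_know j| <= #|S|)%N by apply: subset_leq_card.
  rewrite k3 leq_eqVlt => /orP[/eqP cS|].
    have <- : vamos_know j = S by apply/eqP; rewrite eqEcard kS k3 -cS.
    rewrite {1}/vamos_rank circ (vamos_circuit_card _ circ) vamos_rank_free k3 //.
  rewrite leq_eqVlt => /orP[/eqP cS|cS]; last first.
    rewrite !vamos_rank_free ?c1 -?cS ?gtn_eqF //; last exact: leqW.
    by rewrite !(minn_idPr _) // ltnW // ltnW.
  rewrite vamos_rank_free c1 -?cS // /vamos_rank -cS.
  case: (boolP (S \in _)) => // SC; have SE : S = vamos_want j |: vamos_know j.
    apply: vamos_circuitI => //; apply: (@leq_trans #|vamos_know j|); first by rewrite k3.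
    apply: subset_leq_card.
    by rewrite subsetI kS subsetUr.
  by rewrite SE setU11 in wS.
- have cS : (3 < #|S|)%N by apply: leq_trans k4 (subset_leq_card kS).
  rewrite vamos_rank_free c1 ?gtn_eqF // (minn_idPr _) ?leqW //.
  move: cS; rewrite leq_eqVlt => /orP[/eqP cS|cS]; last first.
    by rewrite vamos_rank_free ?gtn_eqF // (minn_idPr _) // ltnW.
  have kE : vamos_know j = S by apply/eqP; rewrite eqEcard kS -cS.
  by rewrite /vamos_rank -kE (negPf free) kE -cS.
Qed.

(** Cardinalities suffice unless |Z| = 3. There a failure would need both [a |: Z] and [b |: Z] to
    be circuits, and they share three elements. *)
Lemma vamos_rank_submod (Z : {set 'I_8}) a b : a != b -> a \notin Z -> b \notin Z ->
  (vamos_rank (a |: (b |: Z)) + vamos_rank Z <= vamos_rank (a |: Z) + vamos_rank (b |: Z))%N.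
Proof.
move=> ab aZ bZ.
have ca : #|a |: Z| = #|Z|.+1 by rewrite cardsU1 aZ.
have cb : #|b |: Z| = #|Z|.+1 by rewrite cardsU1 bZ.
have cab : #|a |: (b |: Z)| = #|Z|.+2 by rewrite cardsU1 cb !inE (negPf ab) aZ.
have := vamos_rank_bounds (a |: (b |: Z)); have := vamos_rank_bounds Z.
have := vamos_rank_bounds (a |: Z); have := vamos_rank_bounds (b |: Z).
rewrite cab ca cb; have [Z3|] := eqVneq #|Z| 3%N; last by move: #|Z| => k; lia.
rewrite Z3 /= /vamos_rank cab ca cb Z3 /= => _ _ _ _.
case: (boolP (a |: Z \in _)) => aC; case: (boolP (b |: Z \in _)) => bC; do 1?lia.
suff /setP/(_ a) : a |: Z = b |: Z by rewrite !inE eqxx (negPf ab) (negPf aZ).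
apply: vamos_circuitI => //; apply: (@leq_trans #|Z|); first by rewrite Z3.
apply: subset_leq_card; by rewrite subsetI !subsetUr.
Qed.

Lemma vamos_feasible (R : realType) :
  feasible R vamos 2 (fun S => 4 + (vamos_rank S)%:R).
Proof.
have step (S : {set 'I_8}) x : x \notin S ->
    (vamos_rank S <= vamos_rank (x |: S) <= vamos_rank S + 1)%N.
  move=> xS; have cx : #|x |: S| = #|S|.+1 by rewrite cardsU1 xS.
  have := vamos_rank_bounds S; have := vamos_rank_bounds (x |: S).
  by rewrite cx; move: #|S| => k; lia.
apply: feasible2_local => /=.
- by rewrite vamos_rank_free cardsT card_ord //= -natrD ler_nat.
- by rewrite addr_ge0 ?ler0n.
- by move=> S x /step/andP[_]; rewrite -(ler_nat R) natrD; lra.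
- by move=> S x xS; rewrite lerD2l ler_nat; case/andP: (step S x xS).
- by move=> S j kS wS; rewrite vamos_rank_closure.
- move=> Z a b ab aZ bZ; have := vamos_rank_submod Z a b ab aZ bZ.
  rewrite -(ler_nat R) !natrD; lra.
Qed.

Lemma bval2_vamos (R : realType) : bval R vamos 2 <= 4.
Proof.
apply: le_trans (bval_le _ _ _ _ (vamos_feasible R)) _.
by rewrite vamos_rank_free cards0 //= addr0.
Qed.

(** What is known after the receivers [js] have decoded in turn; [valid_chain] checks that each has
    its side information when its turn comes. *)
Fixpoint decode_chain (s : seq nat) (js : seq nat) : seq nat :=
  if js is j :: js' then decode_chain ((nth (0%N, [::]) vamos_receivers j).1 :: s) js' else s.

Fixpoint valid_chain (s : seq nat) (js : seq nat) : bool :=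
  if js is j :: js' then
    [&& j < 10, all (mem s) (nth (0%N, [::]) vamos_receivers j).2 &
        valid_chain ((nth (0%N, [::]) vamos_receivers j).1 :: s) js']%N
  else true.

(** The circuits give Y(ab), Y(ac), Y(bc), Y(ad), Y(bd) <= X(0) + 3. Decoding gives Y(cd), Y(abc),
    Y(abd) >= 8, and Y(a), Y(b), Y(c) >= 6, since two more elements suffice to decode everything.
    Zhang-Yeung then reads 78 <= 11 X(0) + 33. *)
Lemma beta_vamos (R : realType) : 45 / 11 <= beta R vamos.
Proof.
apply: le_beta => t p t0 /(solution_entropy R _ _ _ t0)[X [[[/= Xn X0 Xslope Xmono Xdec] _] Xp zy]].
apply: le_trans Xp; pose Y s := X (vset s).
have chain js : forall s, valid_chain s js -> Y (decode_chain s js) <= Y s.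
  elim: js => //= j js IH s /and3P[j10 ks vj]; apply: (le_trans (IH _ vj)).
  apply: Xdec; split=> [|x]; first by apply: vset_sub; apply/allP => y ys; rewrite /= inE ys orbT.
  rewrite !inE => /andP[xs]; rewrite (negPf xs) orbF => /eqP xj; exists (Ordinal j10).
  split; last by apply: vset_sub.
  by apply: val_inj; rewrite /= vamos_wantE xj.
have slope s s' : all (mem s') s ->
    Y s' <= Y s + (count (fun k : nat => (k \in s') && (k \notin s)) (iota 0%N 8%N))%:R.
  move=> /vset_sub/Xslope; rewrite (_ : vset s' :\: vset s =
    [set i : 'I_8 | (i : nat) \in [pred k : nat | (k \in s') && (k \notin s)]]).
    by rewrite card_vset_cond.
  by apply/setP => i; rewrite !inE andbC.
have full js s : valid_chain s js -> all (mem (decode_chain s js)) (iota 0%N 8%N) -> 8 <= Y s.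
  move=> vs /allP h; apply: le_trans (chain _ _ vs); apply: (le_trans Xn).
  rewrite (_ : [set: _] = vset (decode_chain s js)) //.
  by apply/setP => i; rewrite !inE; apply/esym/h; rewrite mem_iota /= ltn_ord.
have eqY s1 s2 : all (fun k : nat => (k \in s1) == (k \in s2)) (iota 0%N 8%N) -> Y s1 = Y s2.
  by move=> /vset_eq e; rewrite /Y e.
have Y0 : Y [::] = X set0 by congr X; apply/setP => i; rewrite !inE.
have three c j s : valid_chain s [:: j] ->
    all (fun k : nat => (k \in decode_chain s [:: j]) == (k \in c)) (iota 0%N 8%N) ->
    count (fun k : nat => (k \in s) && (k \notin [::])) (iota 0%N 8%N) = 3%N -> Y c <= X set0 + 3.
  move=> vs /eqY <- c3; apply: (le_trans (chain _ _ vs)).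
  by have := slope [::] s isT; rewrite c3 Y0.
have ab := three [:: 0; 1; 2; 3]%N 0%N [:: 0; 1; 2]%N isT isT erefl.
have ac := three [:: 0; 1; 4; 5]%N 1%N [:: 0; 1; 4]%N isT isT erefl.
have bc := three [:: 2; 3; 4; 5]%N 2%N [:: 2; 3; 4]%N isT isT erefl.
have ad := three [:: 0; 1; 6; 7]%N 3%N [:: 0; 1; 6]%N isT isT erefl.
have bd := three [:: 2; 3; 6; 7]%N 4%N [:: 2; 3; 6]%N isT isT erefl.
have cd := full [:: 5; 6; 7; 0]%N [:: 4; 5; 6; 7]%N isT isT.
have abc := full [:: 8; 3]%N [:: 0; 1; 2; 3; 4; 5]%N isT isT.
have abd := full [:: 9; 1]%N [:: 0; 1; 2; 3; 6; 7]%N isT isT.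
have acd := full [:: 1; 3; 7; 0]%N [:: 0; 1; 4; 6]%N isT isT.
have bcd := full [:: 2; 4; 5; 6]%N [:: 2; 3; 4; 6]%N isT isT.
have a2 : Y [:: 0; 1; 4; 6]%N <= Y [:: 0; 1]%N + 2 := slope [:: 0; 1]%N [:: 0; 1; 4; 6]%N isT.
have b2 : Y [:: 2; 3; 4; 6]%N <= Y [:: 2; 3]%N + 2 := slope [:: 2; 3]%N [:: 2; 3; 4; 6]%N isT.
have c2 : Y [:: 4; 5; 6; 7]%N <= Y [:: 4; 5]%N + 2 := slope [:: 4; 5]%N [:: 4; 5; 6; 7]%N isT.
have := zy (vset [:: 0; 1]%N) (vset [:: 2; 3]%N) (vset [:: 4; 5]%N) (vset [:: 6; 7]%N).
have U s1 s2 : vset s1 :|: vset s2 = vset (s1 ++ s2).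
  by apply/setP => i; rewrite !inE mem_cat.
rewrite !U /= -!/(Y _); lra.
Qed.

(** * The directed triangle *)

Lemma ordS_neq (j : 'I_3) : j \notin [set ordS j].
Proof. by rewrite inE; case: j => [[|[|[|]]]]. Qed.

Definition cycle3 : bsi := @BSI 3 3 id (fun j => [set ordS j]) ordS_neq.

Lemma cycle3_beta (R : realType) : beta R cycle3 <= 2.
Proof.
(* Messages are single bits; the receiver for x2 knows x0 and recovers first x1, then x2. *)
pose b (x : msgs cycle3 1) (k : nat) : bool := (x (inord k) : nat) == 0%N.
have sol : solution cycle3 1 4.
  apply: (@solution_of_encoder cycle3 1 4 (bool * bool)%type
     (fun x => (b x 0 (+) b x 1, b x 1 (+) b x 2))%N).
    by rewrite card_prod card_bool.
  move=> x y j [e01 e12] known.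
  have bj k : (k < 3)%N -> b x k = b y k -> x (inord k) = y (inord k).
    rewrite /b; case: (x _) (y _) => [[|[|?]] //= ?] [[|[|?]] //= ?] _ //= _;
      exact: val_inj.
  have kn : b x (ordS j) = b y (ordS j).
    by rewrite /b known // inord_val inE.
  have := bj j (ltn_ord j); rewrite inord_val; apply; move: kn e01 e12; clear.
  case: j => [[|[|[|]]]] //= _ ->.
  - by move/addIb.
  - by move=> _ /addIb.
  - by move/addbI=> -> /addbI.
by have := beta_le R cycle3 1 4 isT sol; rewrite divr1.
Qed.

(** A set serving both i and j would force each to be the other or its successor, so i = j. Hence
    the three unit demands use disjoint families of sets. *)
Lemma cycle3_bval (R : realType) : 3 <= bval R cycle3 3.
Proof.
apply: le_bval => X /feasible_cover[m [m0 cover]]; apply: le_trans.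
pose good (j : 'I_3) (T : {set 'I_3}) := (j \in T) && (T \subset j |: [set ordS j]).
have -> : 3 = \sum_(j < 3) 1 :> R by rewrite sumr_const card_ord.
apply: (@le_trans _ _ (\sum_(j < 3) \sum_(T | good j T) m T)).
  by apply: ler_sum => j _; apply: cover.
rewrite (exchange_big_dep xpredT) //=; apply: ler_sum => T _; rewrite sumr_const.
rewrite -[X in _ <= X]mulr1n; apply: ler_wpMn2l => //.
apply/card_le1_eqP => i j; rewrite !unfold_in => /andP[iT /subsetP si] /andP[jT /subsetP sj].
have := si j jT; have := sj i iT; rewrite !inE -!(inj_eq val_inj) => h1 h2; apply: val_inj.
by move: h1 h2; case: i {iT si} => [[|[|[|]]]] // ?; case: j {jT sj} => [[|[|[|]]]].
Qed.

Theorem theorem1 (R : realType) :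
  (* (a) B_k is a relaxation of B_{k+1}, hence b_k <= b_{k+1} *)
  (forall (G : bsi) (k : nat), (1 <= k)%N -> (k < nmsg G)%N ->
     (forall X, feasible R G k.+1 X -> feasible R G k X) /\
     bval R G k <= bval R G k.+1) /\
  (* (b) b_2 <= beta <= b_n *)
  (forall G : bsi, bval R G 2 <= beta R G /\ beta R G <= bval R G (nmsg G)) /\
  (* (c) both inequalities can be strict *)
  (exists G : bsi, bval R G 2 < beta R G) /\
  (exists G : bsi, beta R G < bval R G (nmsg G)) /\
  (* (d) graphs *)
  (forall (n : nat) (e : rel 'I_n) (irr : irreflexive e), symmetric e ->
     bval R (graph_bsi n e irr) 1 = (alpha n e)%:R /\
     bval R (graph_bsi n e irr) n = frac_clique_cover R n e).
Proof.
split.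
  by move=> G k _ _; split=> [X|]; [apply: feasible_weaken | apply: bval_mono].
split; first by move=> G; split; [apply: bval2_le_beta | apply: beta_le_bval].
split.
  exists vamos; apply: (le_lt_trans (bval2_vamos R)).
  by apply: lt_le_trans (beta_vamos R); lra.
split.
  exists cycle3; apply: (le_lt_trans (cycle3_beta R)).
  by apply: lt_le_trans (cycle3_bval R); lra.
move=> n e irr syme; split; first exact: bval1_graph.
by apply/le_anti; rewrite bval_le_frac_clique_cover frac_clique_cover_le_bval.
Qed.
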